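(* Let $m,n$ be nonnegative integers (not both zero), and let $Z=[z_{ij}]$ be the generator matrix of the right quantum superalgebra $\mathcal M_{m|n}$. Then the following identities of formal power series in $u$ with coefficients in $\mathcal M_{m|n}$ hold: $$\mathrm{Ber}(1+uZ)=\sum_{k=0}^\infty u^k\,\mathrm{str}_{1,\dots,k}\,A_kZ_1\cdots Z_k,$$ $$\big[\mathrm{Ber}(1-uZ)\big]^{-1}=\sum_{k=0}^\infty u^k\,\mathrm{str}_{1,\dots,k}\,H_kZ_1\cdots Z_k,$$ $$\big[\mathrm{Ber}(1+uZ)\big]^{-1}\,\partial_u\,\mathrm{Ber}(1+uZ)=\sum_{k=0}^\infty(-u)^k\,\mathrm{str}\,Z^{k+1}.$$
   Context: The base field is $\mathbb C$. For $1\le i\le m+n$ set $\bar\imath=0$ if $i\le m$ and $\bar\imath=1$ if $i\ge m+1$. In any superalgebra $[x,y]=xy-yx(-1)^{\deg x\deg y}$ for homogeneous $x,y$. The right quantum superalgebra $\mathcal M_{m|n}$ is the associative superalgebra generated by elements $z_{ij}$, $1\le i,j\le m+n$, of parity $\bar\imath+\bar\jmath$, with defining relations $[z_{ij},z_{kl}]=[z_{kj},z_{il}](-1)^{\bar\imath\bar\jmath+\bar\imath\bar k+\bar\jmath\bar k}$ for all $i,j,k,l$. The standard matrix units $e_{ij}\in\mathrm{End}\,\mathbb C^{m|n}$ have parity $\bar\imath+\bar\jmath$. Tensor products of superalgebras use the sign rule $(x\otimes y)(x'\otimes y')=(xx'\otimes yy')(-1)^{\deg y\deg x'}$. In $(\mathrm{End}\,\mathbb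 C^{m|n})^{\otimes k}\otimes\mathcal M_{m|n}$ put $Z_a=\sum_{i,j}1^{\otimes(a-1)}\otimes e_{ij}\otimes1^{\otimes(k-a)}\otimes z_{ij}(-1)^{\bar\imath\bar\jmath+\bar\jmath}$. The natural action of $\mathfrak S_k$ on $(\mathbb C^{m|n})^{\otimes k}$ represents each $\sigma\in\mathfrak S_k$ by an element $P_\sigma$, where the transposition $(a\,b)$, $a<b$, is represented by $P_{ab}=\sum_{i,j}1^{\otimes(a-1)}\otimes e_{ij}\otimes1^{\otimes(b-a-1)}\otimes e_{ji}\otimes1^{\otimes(k-b)}\otimes1\,(-1)^{\bar\jmath}$. $H_k=\frac1{k!}\sum_{\sigma}P_\sigma$ and $A_k=\frac1{k!}\sum_\sigma\mathrm{sgn}\,\sigma\,P_\sigma$. The supertrace $\mathrm{str}_a$ sends $x_1\otimes\dots\otimes e_{ij}\otimes\dots\otimes x_k\otimes y$ ($e_{ij}$ in position $a$) to $\delta_{ij}(-1)^{\bar\imath}x_1\otimes\dots\otimes x_{a-1}\otimes x_{a+1}\otimes\dots\otimes x_k\otimes y$, and $\mathrm{str}_{1,\dots,k}$ is the supertrace over all copies. The $k=0$ terms of the first two sums are $1$. For a matrix $X=[x_{ij}]$, $\mathrm{str}\,X=\sum_i(-1)^{\bar\imath}x_{ii}$; powers $Z^{k}$ are ordinary matrix powers (this agrees with powers of $\sum e_{ij}\otimes z_{ij}(-1)^{\bar\imath\bar\jmath+\bar\jmath}$). The Berezinian is defined, with $Z(u)=1+uZ=[z_{ij}(u)]$, $z_{ij}(u)=\delta_{ij}+z_{ij}u$,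 and $Z(u)^{-1}=[z'_{ij}(u)]$ the inverse matrix over formal power series in $u$, by $$\mathrm{Ber}(1+uZ)=\sum_{\sigma\in\mathfrak S_m}\mathrm{sgn}\,\sigma\; z_{\sigma(1)1}(u)\cdots z_{\sigma(m)m}(u)\;\times\sum_{\tau\in\mathfrak S_n}\mathrm{sgn}\,\tau\; z'_{m+1,m+\tau(1)}(u)\cdots z'_{m+n,m+\tau(n)}(u),$$ and $\mathrm{Ber}(1-uZ)$ is obtained by replacing $u$ by $-u$. *)

(* Defs.v *)
From HB Require Import structures.
From mathcomp Require Import all_boot all_order all_algebra fingroup perm.
From mathcomp Require Import generic_quotient boolp.

Set Implicit Arguments.
Unset Strict Implicit.
Unset Printing Implicit Defensive.

Import GRing.Theory.
Local Open Scope ring_scope.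
Local Open Scope quotient_scope.

(* Formal power series f = \sum_k f k u^k in a central variable u. *)

Definition fps (S : pzRingType) : Type := nat -> S.

Section FormalPowerSeries.
Variable S : pzRingType.
Implicit Types f g h : fps S.

HB.instance Definition _ := gen_eqMixin (fps S).
HB.instance Definition _ := gen_choiceMixin (fps S).

Definition fps_zero : fps S := fun _ => 0.
Definition fps_opp f : fps S := fun k => - f k.
Definition fps_add f g : fps S := fun k => f k + g k.
Definition fpsC (c : S) : fps S := fun k => if k is 0 then c else 0.
Definition fps_mul f g : fps S := fun k => \sum_(i < k.+1) f i * g (k - i)%N.

Fact fps_addA : associative fps_add.
Proof. by move=> f g h; apply: funext => k; rewrite /fps_add addrA. Qed.
Fact fps_addC : commutative fps_add.
Proof. by move=> f g; apply: funext => k; rewrite /fps_add addrC. Qed.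
Fact fps_add0 : left_id fps_zero fps_add.
Proof. by move=> f; apply: funext => k; rewrite /fps_add add0r. Qed.
Fact fps_addN : left_inverse fps_zero fps_opp fps_add.
Proof. by move=> f; apply: funext => k; rewrite /fps_add addNr. Qed.

HB.instance Definition _ :=
  GRing.isZmodule.Build (fps S) fps_addA fps_addC fps_add0 fps_addN.

Fact fps_mulA : associative fps_mul.
Proof.
move=> f g h; apply: funext => k; rewrite /fps_mul.
pose F (i j : nat) := f i * (g j * h (k - i - j)%N).
transitivity (\sum_(i < k.+1) \sum_(j < k.+1 | (i + j <= k)%N) F i j).
  apply: eq_bigr => -[i /= lik] _; rewrite mulr_sumr.
  rewrite -(big_mkord xpredT (fun j => F i j)).
  rewrite -(big_mkord (fun j => i + j <= k)%N (fun j => F i j)).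
  rewrite (big_nat_widen _ _ k.+1); last by rewrite ltnS leq_subr.
  by apply: eq_bigl => j /=; rewrite ltnS leq_subRL.
transitivity (\sum_(l < k.+1) \sum_(i < k.+1 | (i <= l)%N) F i (l - i)%N); last first.
  apply: eq_bigr => -[l /= llk] _; rewrite mulr_suml.
  rewrite -(big_mkord xpredT (fun i => f i * g (l - i)%N * h (k - l)%N)).
  rewrite -(big_mkord (fun i => i <= l)%N (fun i => F i (l - i)%N)).
  rewrite [RHS](big_nat_widen _ _ k.+1) //.
  apply: eq_bigr => i /= lil; rewrite /F mulrA.
  by rewrite -subnDA subnKC.
rewrite [RHS](exchange_big_dep predT) //=; apply: eq_bigr => -[i /= lik] _.
rewrite -(big_mkord (fun j => i + j <= k)%N (fun j => F i j)).
rewrite -(big_mkord (fun l => i <= l)%N (fun l => F i (l - i)%N)).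
rewrite -[RHS](big_nat_widenl i 0 k.+1 predT) //.
have := big_addn 0 k.+1 i predT (fun l => F i (l - i)%N); rewrite add0n => ->.
transitivity (\sum_(0 <= j < k.+1 - i) F i j).
  rewrite [RHS](big_nat_widen _ _ k.+1) ?leq_subr //.
  by apply: eq_bigl => j /=; rewrite subSn // ltnS leq_subRL.
by apply: eq_bigr => j _; rewrite addnK.
Qed.

Fact fps_mul1f : left_id (fpsC 1) fps_mul.
Proof.
move=> f; apply: funext => k; rewrite /fps_mul big_ord_recl /= mul1r subn0.
by rewrite big1 ?addr0 // => i _; rewrite mul0r.
Qed.
Fact fps_mulf1 : right_id (fpsC 1) fps_mul.
Proof.
move=> f; apply: funext => k; rewrite /fps_mul big_ord_recr /= subnn mulr1.
rewrite big1 ?add0r // => i _; case E: (k - i)%N => [|l]; last by rewrite mulr0.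
by have := ltn_ord i; rewrite -subn_gt0 E.
Qed.
Fact fps_mulDl : left_distributive fps_mul fps_add.
Proof.
move=> f g h; apply: funext => k; rewrite /fps_mul /fps_add -big_split /=.
by apply: eq_bigr => i _; rewrite mulrDl.
Qed.
Fact fps_mulDr : right_distributive fps_mul fps_add.
Proof.
move=> f g h; apply: funext => k; rewrite /fps_mul /fps_add -big_split /=.
by apply: eq_bigr => i _; rewrite mulrDr.
Qed.

HB.instance Definition _ := GRing.Zmodule_isPzRing.Build (fps S)
  fps_mulA fps_mul1f fps_mulf1 fps_mulDl fps_mulDr.

Definition fpsX : fps S := fun k => (k == 1)%:R.

Definition fps_deriv f : fps S := fun k => f k.+1 *+ k.+1.

(* Geometric series for the inverse of f when f 0 = 1: only the powers of
   1 - f up to the k-th one contribute to the coefficient of u^k. *)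
Definition fps_inv f : fps S :=
  fun k => (\sum_(i < k.+1) (1 - f) ^+ i : fps S) k.

Lemma fps_coefD f g k : (f + g) k = f k + g k. Proof. by []. Qed.
Lemma fps_coefN f k : (- f) k = - f k. Proof. by []. Qed.
Lemma fps_coefM f g k : (f * g) k = \sum_(i < k.+1) f i * g (k - i)%N.
Proof. by []. Qed.
Lemma fps_coef_sum I (r : seq I) (P : pred I) (F : I -> fps S) k :
  (\sum_(i <- r | P i) F i) k = \sum_(i <- r | P i) F i k.
Proof. by elim/big_rec2: _ => // i x y _ <-. Qed.

Lemma fps_expr_low f : f 0%N = 0 -> forall i k, (k < i)%N -> (f ^+ i) k = 0.
Proof.
move=> f0; elim=> // i IH k lki; rewrite exprS fps_coefM big1 // => -[j /= ljk] _.
case: j ljk => [|j] ljk; first by rewrite f0 mul0r.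
rewrite IH ?mulr0 // (leq_trans _ (lki : (k <= i)%N)) //.
by rewrite ltn_subrL /= (leq_ltn_trans (leq0n j)).
Qed.

Lemma fps_inv_coef f : f 0%N = 1 -> forall k N, (k <= N)%N ->
  fps_inv f k = (\sum_(i < N.+1) (1 - f) ^+ i : fps S) k.
Proof.
move=> f0 k N lkN; rewrite /fps_inv !fps_coef_sum.
rewrite -(big_mkord xpredT (fun i => ((1 - f) ^+ i) k)).
rewrite -(big_mkord xpredT (fun i => ((1 - f) ^+ i) k)).
rewrite [RHS](big_cat_nat (n := k.+1)) //= -[LHS]addr0; congr (_ + _).
apply/esym; rewrite big_nat_cond big1 // => i /andP[/andP[lki _] _].
by apply: fps_expr_low => //; rewrite fps_coefD fps_coefN f0 subrr.
Qed.

Lemma fps_mulfV f : f 0%N = 1 -> f * fps_inv f = 1.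
Proof.
move=> f0; apply: funext => k.
have h0 : (1 - f) 0%N = 0 by rewrite fps_coefD fps_coefN f0 subrr.
transitivity ((f * \sum_(i < k.+1) (1 - f) ^+ i) k).
  rewrite !fps_coefM; apply: eq_bigr => i _.
  by rewrite (fps_inv_coef f0 (leq_subr i k)).
have -> : f * \sum_(i < k.+1) (1 - f) ^+ i = 1 - (1 - f) ^+ k.+1.
  by rewrite -[RHS]opprB subrX1 -mulNr opprB subKr.
by rewrite fps_coefD fps_coefN fps_expr_low // subr0.
Qed.

Lemma fps_mulVf f : f 0%N = 1 -> fps_inv f * f = 1.
Proof.
move=> f0; have V0 : fps_inv f 0%N = 1 by rewrite /fps_inv big_ord1 expr0.
transitivity (fps_inv f * f * (fps_inv f * fps_inv (fps_inv f))).
  by rewrite (fps_mulfV V0) mulr1.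
by rewrite -mulrA (mulrA f) fps_mulfV // mul1r fps_mulfV.
Qed.

End FormalPowerSeries.

Arguments fpsX {S}.

(* The index i : 'I_(m + n) stands for i + 1 in {1, ..., m + n}. *)
Definition par (m n : nat) (i : 'I_(m + n)) : bool := (m <= i)%N.

Definition mxstr (m n : nat) (S : pzRingType) (X : 'M[S]_(m + n)) : S :=
  \sum_i (-1) ^+ par i * X i i.

Definition fps_entry (S : pzRingType) (N : nat) (X : fps 'M[S]_N)
  (i j : 'I_N) : fps S := fun k => X k i j.

(* The matrix over power series Z(u) is encoded as a power series with matrix
   coefficients, assumed to have constant term 1 so that fps_inv Z(u) is its
   inverse. *)
Definition Ber (m n : nat) (S : pzRingType) (Zu : fps 'M[S]_(m + n)) : fps S :=
  (\sum_(s : 'S_m) (-1) ^+ s *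
     \prod_(i < m) fps_entry Zu (lshift n (s i)) (lshift n i)) *
  (\sum_(t : 'S_n) (-1) ^+ t *
     \prod_(j < n) fps_entry (fps_inv Zu) (rshift m j) (rshift m (t j))).

Lemma Ber_coef0 (m n : nat) (S : pzRingType) (Zu : fps 'M[S]_(m + n)) :
  Zu 0%N = 1 -> Ber Zu 0%N = 1.
Proof.
move=> Z0.
have coefM0 (f g : fps S) : (f * g) 0%N = f 0%N * g 0%N.
  by rewrite fps_coefM big_ord1.
have prod0 k (f : 'I_k -> fps S) : (\prod_i f i) 0%N = \prod_i f i 0%N.
  by elim/big_rec2: _ => // i x y _ <-; rewrite coefM0.
have sgn0 (b : bool) : ((-1) ^+ b : fps S) 0%N = (-1) ^+ b by case: b.
have V0 : fps_inv Zu 0%N = 1 by rewrite /fps_inv big_ord1 expr0.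
have perm0 k (s : 'S_k) : s != 1%g -> exists i, s i != i.
  move=> ne1; apply/existsP; apply: contraNT ne1; rewrite negb_exists.
  move=> /forallP H; apply/eqP/permP => i; rewrite perm1; apply/eqP.
  by have := H i; rewrite negbK.
have zeroprod k (f : 'I_k -> S) i : f i = 0 -> \prod_j f j = 0.
  elim: k f i => [|k IH] f i fi; first by case: i fi.
  rewrite big_ord_recl; case: (unliftP ord0 i) fi => [j|] -> fi.
    by rewrite (IH (fun j => f (lift ord0 j)) j) ?mulr0.
  by rewrite fi mul0r.
rewrite /Ber coefM0 !fps_coef_sum -[RHS]mulr1; congr (_ * _).
  rewrite (bigD1 1%g) //= [X in _ + X]big1 ?addr0 => [|s /perm0[i nei]].
    rewrite coefM0 sgn0 prod0 odd_perm1 mul1r big1 // => i _.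
    by rewrite /fps_entry Z0 mxE perm1 eqxx.
  rewrite coefM0 prod0 (@zeroprod _ _ i) ?mulr0 //.
  by rewrite /fps_entry Z0 mxE (inj_eq (@lshift_inj _ _)) (negbTE nei).
rewrite (bigD1 1%g) //= [X in _ + X]big1 ?addr0 => [|s /perm0[i nei]].
  rewrite coefM0 sgn0 prod0 odd_perm1 mul1r big1 // => i _.
  by rewrite /fps_entry V0 mxE perm1 eqxx.
rewrite coefM0 prod0 (@zeroprod _ _ i) ?mulr0 //.
by rewrite /fps_entry V0 mxE (inj_eq (@rshift_inj _ _)) eq_sym (negbTE nei).
Qed.

(* The supercommutator of homogeneous x and y of degrees p and q. *)
Definition scomm (S : pzRingType) (p q : bool) (x y : S) : S :=
  x * y - (-1) ^+ (p * q) * (y * x).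

Section RightQuantumSuperalgebra.
Variables (F : fieldType) (m n : nat).
Notation N := (m + n)%N.

Definition right_quantum (S : pzRingType) (z : 'I_N -> 'I_N -> S) : Prop :=
  forall i j k l : 'I_N,
    scomm (par i (+) par j) (par k (+) par l) (z i j) (z k l) =
    (-1) ^+ (par i * par j + par i * par k + par j * par k) *
    scomm (par k (+) par j) (par i (+) par l) (z k j) (z i l).

(* The algebra presented by the generators z_ij and the defining relations is
   the quotient of formal expressions by the least congruence containing the
   axioms of associative unital F-algebras and these relations. *)
Inductive rq_term : Type :=
  | RQgen of 'I_N & 'I_N
  | RQ0
  | RQ1
  | RQopp of rq_term
  | RQadd of rq_term & rq_term
  | RQmul of rq_term & rq_term
  | RQscale of F & rq_term.

Definition rq_sgn (d : nat) : rq_term -> rq_term := RQscale ((-1) ^+ d).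

Definition rq_scomm (i j k l : 'I_N) : rq_term :=
  RQadd (RQmul (RQgen i j) (RQgen k l))
    (RQopp (rq_sgn ((par i (+) par j) * (par k (+) par l))
       (RQmul (RQgen k l) (RQgen i j)))).

Inductive rq_eq : rq_term -> rq_term -> Prop :=
  | rq_refl x : rq_eq x x
  | rq_sym x y : rq_eq x y -> rq_eq y x
  | rq_trans x y z : rq_eq x y -> rq_eq y z -> rq_eq x z
  | rq_opp_congr x x' : rq_eq x x' -> rq_eq (RQopp x) (RQopp x')
  | rq_add_congr x x' y y' :
      rq_eq x x' -> rq_eq y y' -> rq_eq (RQadd x y) (RQadd x' y')
  | rq_mul_congr x x' y y' :
      rq_eq x x' -> rq_eq y y' -> rq_eq (RQmul x y) (RQmul x' y')
  | rq_scale_congr c x x' : rq_eq x x' -> rq_eq (RQscale c x) (RQscale c x')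
  | rq_addA x y z : rq_eq (RQadd x (RQadd y z)) (RQadd (RQadd x y) z)
  | rq_addC x y : rq_eq (RQadd x y) (RQadd y x)
  | rq_add0 x : rq_eq (RQadd RQ0 x) x
  | rq_addN x : rq_eq (RQadd (RQopp x) x) RQ0
  | rq_mulA x y z : rq_eq (RQmul x (RQmul y z)) (RQmul (RQmul x y) z)
  | rq_mul1x x : rq_eq (RQmul RQ1 x) x
  | rq_mulx1 x : rq_eq (RQmul x RQ1) x
  | rq_mulDl x y z :
      rq_eq (RQmul (RQadd x y) z) (RQadd (RQmul x z) (RQmul y z))
  | rq_mulDr x y z :
      rq_eq (RQmul x (RQadd y z)) (RQadd (RQmul x y) (RQmul x z))
  | rq_scaleA a b x : rq_eq (RQscale a (RQscale b x)) (RQscale (a * b) x)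
  | rq_scale1 x : rq_eq (RQscale 1 x) x
  | rq_scaleDr a x y :
      rq_eq (RQscale a (RQadd x y)) (RQadd (RQscale a x) (RQscale a y))
  | rq_scaleDl a b x :
      rq_eq (RQscale (a + b) x) (RQadd (RQscale a x) (RQscale b x))
  | rq_scaleAl a x y : rq_eq (RQscale a (RQmul x y)) (RQmul (RQscale a x) y)
  | rq_scaleAr a x y : rq_eq (RQscale a (RQmul x y)) (RQmul x (RQscale a y))
  | rq_rel i j k l :
      rq_eq (rq_scomm i j k l)
        (rq_sgn (par i * par j + par i * par k + par j * par k)
           (rq_scomm k j i l)).

HB.instance Definition _ := gen_eqMixin rq_term.
HB.instance Definition _ := gen_choiceMixin rq_term.

Definition rq_eqb (x y : rq_term) : bool := `[< rq_eq x y >].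

Fact rq_eqb_refl : reflexive rq_eqb.
Proof. by move=> x; apply/asboolP; apply: rq_refl. Qed.
Fact rq_eqb_sym : symmetric rq_eqb.
Proof. by move=> x y; apply/asboolP/asboolP; apply: rq_sym. Qed.
Fact rq_eqb_trans : transitive rq_eqb.
Proof. by move=> y x z /asboolP xy /asboolP yz; apply/asboolP/(rq_trans xy). Qed.

Canonical rq_equiv := EquivRel rq_eqb rq_eqb_refl rq_eqb_sym rq_eqb_trans.

Definition rqM : Type := {eq_quot rq_equiv}.

HB.instance Definition _ := Choice.copy rqM {eq_quot rq_equiv}.

Definition rq_pi (t : rq_term) : rqM := \pi_{eq_quot rq_equiv} t.
Definition rq_repr (x : rqM) : rq_term := repr (x : {eq_quot rq_equiv}).

Lemma rq_piP s t : rq_pi s = rq_pi t <-> rq_eq s t.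
Proof.
split=> [e|e]; last by apply/(@eqmodP _ rq_equiv)/asboolP.
by apply/asboolP; apply/(@eqmodP _ rq_equiv).
Qed.
Lemma rq_reprK x : rq_pi (rq_repr x) = x.
Proof. exact: (@reprK _ {eq_quot rq_equiv}). Qed.
Lemma rq_pi_repr t : rq_eq (rq_repr (rq_pi t)) t.
Proof. by apply/rq_piP; rewrite rq_reprK. Qed.
Lemma rq_ind (P : rqM -> Prop) : (forall t, P (rq_pi t)) -> forall x, P x.
Proof. by move=> H x; rewrite -(rq_reprK x). Qed.

Definition rqM_opp (x : rqM) := rq_pi (RQopp (rq_repr x)).
Definition rqM_add (x y : rqM) := rq_pi (RQadd (rq_repr x) (rq_repr y)).
Definition rqM_mul (x y : rqM) := rq_pi (RQmul (rq_repr x) (rq_repr y)).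
Definition rqM_scale (c : F) (x : rqM) := rq_pi (RQscale c (rq_repr x)).

Let piN t : rqM_opp (rq_pi t) = rq_pi (RQopp t).
Proof. exact/rq_piP/rq_opp_congr/rq_pi_repr. Qed.
Let piD s t : rqM_add (rq_pi s) (rq_pi t) = rq_pi (RQadd s t).
Proof. by apply/rq_piP/rq_add_congr; apply: rq_pi_repr. Qed.
Let piM s t : rqM_mul (rq_pi s) (rq_pi t) = rq_pi (RQmul s t).
Proof. by apply/rq_piP/rq_mul_congr; apply: rq_pi_repr. Qed.
Let piZ c t : rqM_scale c (rq_pi t) = rq_pi (RQscale c t).
Proof. exact/rq_piP/rq_scale_congr/rq_pi_repr. Qed.
Let piE := (piN, piD, piM, piZ).

Fact rqM_addA : associative rqM_add.
Proof.
elim/rq_ind=> x; elim/rq_ind=> y; elim/rq_ind=> z; rewrite !piE.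
exact/rq_piP/rq_addA.
Qed.
Fact rqM_addC : commutative rqM_add.
Proof. by elim/rq_ind=> x; elim/rq_ind=> y; rewrite !piE; exact/rq_piP/rq_addC. Qed.
Fact rqM_add0 : left_id (rq_pi RQ0) rqM_add.
Proof. by elim/rq_ind=> x; rewrite !piE; exact/rq_piP/rq_add0. Qed.
Fact rqM_addN : left_inverse (rq_pi RQ0) rqM_opp rqM_add.
Proof. by elim/rq_ind=> x; rewrite !piE; exact/rq_piP/rq_addN. Qed.

HB.instance Definition _ :=
  GRing.isZmodule.Build rqM rqM_addA rqM_addC rqM_add0 rqM_addN.

Fact rqM_mulA : associative rqM_mul.
Proof.
elim/rq_ind=> x; elim/rq_ind=> y; elim/rq_ind=> z; rewrite !piE.
exact/rq_piP/rq_mulA.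
Qed.
Fact rqM_mul1x : left_id (rq_pi RQ1) rqM_mul.
Proof. by elim/rq_ind=> x; rewrite !piE; exact/rq_piP/rq_mul1x. Qed.
Fact rqM_mulx1 : right_id (rq_pi RQ1) rqM_mul.
Proof. by elim/rq_ind=> x; rewrite !piE; exact/rq_piP/rq_mulx1. Qed.
Fact rqM_mulDl : left_distributive rqM_mul rqM_add.
Proof.
elim/rq_ind=> x; elim/rq_ind=> y; elim/rq_ind=> z; rewrite !piE.
exact/rq_piP/rq_mulDl.
Qed.
Fact rqM_mulDr : right_distributive rqM_mul rqM_add.
Proof.
elim/rq_ind=> x; elim/rq_ind=> y; elim/rq_ind=> z; rewrite !piE.
exact/rq_piP/rq_mulDr.
Qed.

Section Evaluation.
Variables (A : algType F) (z : 'I_N -> 'I_N -> A).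

Fixpoint rq_eval_term (t : rq_term) : A :=
  match t with
  | RQgen i j => z i j
  | RQ0 => 0
  | RQ1 => 1
  | RQopp x => - rq_eval_term x
  | RQadd x y => rq_eval_term x + rq_eval_term y
  | RQmul x y => rq_eval_term x * rq_eval_term y
  | RQscale c x => c *: rq_eval_term x
  end.

Definition rq_eval (x : rqM) : A := rq_eval_term (rq_repr x).

Lemma rq_eval_congr : right_quantum z ->
  forall s t, rq_eq s t -> rq_eval_term s = rq_eval_term t.
Proof.
move=> zrel s t; elim=> /=.
- by [].
- by move=> x y _ ->.
- by move=> x y w _ -> _ ->.
- by move=> x x' _ ->.
- by move=> x x' y y' _ -> _ ->.
- by move=> x x' y y' _ -> _ ->.
- by move=> c x x' _ ->.
- by move=> *; rewrite addrA.
- by move=> *; rewrite addrC.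
- by move=> *; rewrite add0r.
- by move=> *; rewrite addNr.
- by move=> *; rewrite mulrA.
- by move=> *; rewrite mul1r.
- by move=> *; rewrite mulr1.
- by move=> *; rewrite mulrDl.
- by move=> *; rewrite mulrDr.
- by move=> *; rewrite scalerA.
- by move=> *; rewrite scale1r.
- by move=> *; rewrite scalerDr.
- by move=> *; rewrite scalerDl.
- by move=> *; rewrite scalerAl.
- by move=> *; rewrite scalerAr.
- move=> i j k l; have := zrel i j k l; rewrite /scomm.
  have sgnE d (x : A) : (-1) ^+ d *: x = (-1) ^+ d * x.
    by rewrite -[in LHS]signr_odd -[in RHS]signr_odd scaler_sign mulr_sign.
  by rewrite !sgnE.
Qed.

Hypothesis zrel : right_quantum z.

Lemma rq_eval_pi t : rq_eval (rq_pi t) = rq_eval_term t.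
Proof. exact: (rq_eval_congr zrel (rq_pi_repr t)). Qed.

End Evaluation.

Fact rqM_oner_neq0 : rq_pi RQ1 != rq_pi RQ0.
Proof.
apply/eqP => /rq_piP e; have z0 : right_quantum (fun _ _ : 'I_N => 0 : F^o).
  by move=> i j k l; rewrite /scomm !mulr0 subr0 mulr0.
by have /eqP := rq_eval_congr z0 e; rewrite /= oner_eq0.
Qed.

HB.instance Definition _ := GRing.Zmodule_isNzRing.Build rqM
  rqM_mulA rqM_mul1x rqM_mulx1 rqM_mulDl rqM_mulDr rqM_oner_neq0.

Fact rqM_scaleA a b x : rqM_scale a (rqM_scale b x) = rqM_scale (a * b) x.
Proof. by elim/rq_ind: x => x; rewrite !piE; exact/rq_piP/rq_scaleA. Qed.
Fact rqM_scale1 : left_id 1 rqM_scale.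
Proof. by elim/rq_ind=> x; rewrite !piE; exact/rq_piP/rq_scale1. Qed.
Fact rqM_scaleDr : right_distributive rqM_scale +%R.
Proof.
move=> a; elim/rq_ind=> x; elim/rq_ind=> y.
by rewrite [_ + _]piE !piE [RHS]piE; exact/rq_piP/rq_scaleDr.
Qed.
Fact rqM_scaleDl x : {morph rqM_scale^~ x : a b / a + b}.
Proof.
by move=> a b; elim/rq_ind: x => x; rewrite !piE [RHS]piE; exact/rq_piP/rq_scaleDl.
Qed.

HB.instance Definition _ := GRing.Zmodule_isLmodule.Build F rqM
  rqM_scaleA rqM_scale1 rqM_scaleDr rqM_scaleDl.

Fact rqM_scaleAl (a : F) (x y : rqM) : a *: (x * y) = (a *: x) * y.
Proof.
elim/rq_ind: x => x; elim/rq_ind: y => y.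
rewrite [_ * _]piE [LHS]piE [a *: _]piE [RHS]piE; exact/rq_piP/rq_scaleAl.
Qed.
HB.instance Definition _ := GRing.Lmodule_isLalgebra.Build F rqM rqM_scaleAl.

Fact rqM_scaleAr (a : F) (x y : rqM) : a *: (x * y) = x * (a *: y).
Proof.
elim/rq_ind: x => x; elim/rq_ind: y => y.
rewrite [_ * _]piE [LHS]piE [a *: _]piE [RHS]piE; exact/rq_piP/rq_scaleAr.
Qed.
HB.instance Definition _ := GRing.Lalgebra_isAlgebra.Build F rqM rqM_scaleAr.

Definition rq_gen (i j : 'I_N) : rqM := rq_pi (RQgen i j).

Lemma rq_eval_gen (A : algType F) (z : 'I_N -> 'I_N -> A) i j :
  right_quantum z -> rq_eval z (rq_gen i j) = z i j.
Proof. by move=> zrel; rewrite /rq_gen rq_eval_pi. Qed.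

Lemma rq_eval_is_linear (A : algType F) (z : 'I_N -> 'I_N -> A) :
  right_quantum z -> linear (rq_eval z).
Proof.
move=> zrel a; elim/rq_ind=> x; elim/rq_ind=> y.
by rewrite [a *: _]piE [_ + _]piE !rq_eval_pi.
Qed.

Lemma rq_eval_is_monoid_morphism (A : algType F) (z : 'I_N -> 'I_N -> A) :
  right_quantum z -> monoid_morphism (rq_eval z).
Proof.
move=> zrel; split; first by rewrite [LHS]rq_eval_pi.
by elim/rq_ind=> x; elim/rq_ind=> y; rewrite [_ * _]piE !rq_eval_pi.
Qed.

Lemma rq_gen_rel : right_quantum rq_gen.
Proof.
have sgnE d (x : rqM) : (-1) ^+ d * x = (-1) ^+ d *: x.
  by rewrite -[in LHS]signr_odd -[in RHS]signr_odd scaler_sign mulr_sign.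
have scE i j k l : scomm (par i (+) par j) (par k (+) par l)
    (rq_gen i j) (rq_gen k l) = rq_pi (rq_scomm i j k l).
  rewrite /scomm sgnE [X in X - _]piE [X in _ *: X]piE [_ *: _]piE.
  by rewrite [- _]piE [LHS]piE.
by move=> i j k l; rewrite !scE sgnE [RHS]piE; apply/rq_piP/rq_rel.
Qed.

Lemma rq_gen_sgn_rel :
  right_quantum (fun i j => (-1) ^+ (par i (+) par j) *: rq_gen i j).
Proof.
have H (p q : bool) (x y : rqM) :
    ((-1) ^+ p *: x) * ((-1) ^+ q *: y) = (-1) ^+ (p (+) q) *: (x * y).
  by rewrite -scalerAl -scalerAr scalerA signr_addb.
move=> i j k l; have := rq_gen_rel i j k l; rewrite /scomm /= !H => e.
rewrite [par k (+) _ (+) (par i (+) _)]addbC.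
have -> : par k (+) par j (+) (par i (+) par l) =
          par i (+) par j (+) (par k (+) par l).
  by case: (par i); case: (par j); case: (par k); case: (par l).
have -> : par i (+) par l (+) (par k (+) par j) =
          par i (+) par j (+) (par k (+) par l).
  by case: (par i); case: (par j); case: (par k); case: (par l).
by rewrite -!scalerAr -!scalerBr e scalerAr.
Qed.

(* The parity automorphism x |-> (-1)^(deg x) x. It encodes the Z/2-grading of
   rqM in which z_ij has degree par i + par j: the component of degree d of rqM
   is its eigenspace for the eigenvalue (-1)^d. *)
Definition rq_parity : rqM -> rqM :=
  rq_eval (fun i j => (-1) ^+ (par i (+) par j) *: rq_gen i j).

HB.instance Definition _ := GRing.isLinear.Build F rqM rqM *:%R rq_parity
  (rq_eval_is_linear rq_gen_sgn_rel).
HB.instance Definition _ := GRing.isMonoidMorphism.Build rqM rqM rq_parity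
  (rq_eval_is_monoid_morphism rq_gen_sgn_rel).

Lemma rq_parity_gen i j :
  rq_parity (rq_gen i j) = (-1) ^+ (par i (+) par j) *: rq_gen i j.
Proof. exact: rq_eval_gen rq_gen_sgn_rel. Qed.

Lemma rq_parityK : involutive rq_parity.
Proof.
elim/rq_ind; elim=> [i j|||x IH|x IHx y IHy|x IHx y IHy|c x IH].
- by rewrite rq_parity_gen linearZ /= rq_parity_gen scalerA -signr_addb addbb scale1r.
- by rewrite [rq_pi RQ0](_ : _ = 0) // !linear0.
- by rewrite [rq_pi RQ1](_ : _ = 1) // !rmorph1.
- by rewrite -piN -[rqM_opp _]/(- rq_pi x) !linearN /= IH.
- by rewrite -piD -[rqM_add _ _]/(rq_pi x + rq_pi y) !linearD /= IHx IHy.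
- by rewrite -piM -[rqM_mul _ _]/(rq_pi x * rq_pi y) !rmorphM /= IHx IHy.
- by rewrite -piZ -[rqM_scale _ _]/(c *: rq_pi x) !linearZ /= IH.
Qed.

Definition rq_homog (d : bool) (x : rqM) : Prop :=
  rq_parity x = (-1) ^+ d *: x.

(* x |-> (-1)^(d deg x) x *)
Definition rq_twist (d : nat) (x : rqM) : rqM := iter d rq_parity x.

End RightQuantumSuperalgebra.

Section TensorSuperalgebra.
Variables (F : fieldType) (m n : nat).
Notation N := (m + n)%N.
Notation M := (rqM F m n).

Lemma rq_twist_odd d (x : M) : rq_twist d x = rq_twist (odd d) x.
Proof.
rewrite -{1}(odd_double_half d) /rq_twist iterD; congr (iter _ _ _).
by elim: d./2 => // e IH; rewrite doubleS !iterS rq_parityK.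
Qed.

Lemma rq_twistD d e (x : M) : rq_twist (d + e) x = rq_twist d (rq_twist e x).
Proof. exact: iterD. Qed.

Lemma rq_twist_linear d : linear (@rq_twist F m n d).
Proof.
by move=> c x y; elim: d => // d IH; rewrite /rq_twist !iterS -!/(rq_twist _ _) IH linearP.
Qed.

HB.instance Definition _ d := GRing.isLinear.Build F M M *:%R (@rq_twist F m n d)
  (@rq_twist_linear d).

Lemma rq_twistM d (x y : M) : rq_twist d (x * y) = rq_twist d x * rq_twist d y.
Proof. by elim: d => // d IH; rewrite /rq_twist !iterS -!/(rq_twist _ _) IH rmorphM. Qed.

Lemma rq_twist1 d : rq_twist d (1 : M) = 1.
Proof. by elim: d => // d IH; rewrite /rq_twist iterS -/(rq_twist _ _) IH rmorph1. Qed.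

Lemma rq_twist_homog d (p : bool) (x : M) :
  rq_homog p x -> rq_twist d x = (-1) ^+ (d * p) *: x.
Proof.
move=> hx; elim: d => [|d IH]; first by rewrite scale1r.
rewrite /rq_twist iterS -/(rq_twist d x) IH linearZ /= hx scalerA -exprD.
by rewrite mulSn addnC.
Qed.

Definition midx (k : nat) : finType := {ffun 'I_k -> 'I_N}.

(* The degree of the a-th factor of
   e_(I 0, J 0) (x) ... (x) e_(I (k-1), J (k-1)). *)
Definition mdeg k (I J : midx k) (a : 'I_k) : bool := par (I a) (+) par (J a).

(* The exponent of the sign produced by reordering
   x_1 (x) ... (x) x_k (x) x'_1 (x) ... (x) x'_k
   into (x_1 x'_1) (x) ... (x) (x_k x'_k), for x_a, x'_a of degrees p a, q a. *)
Definition koszul k (p q : 'I_k -> bool) : nat :=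
  \sum_(a < k) \sum_(b < k | (b < a)%N) p a * q b.

(* The superalgebra (End C^(m|n))^((x) k) (x) M: X stands for
   \sum_(I, J) e_(I 0, J 0) (x) ... (x) e_(I (k-1), J (k-1)) (x) X (I, J). *)
Definition stens (k : nat) : Type := {ffun midx k * midx k -> M}.

HB.instance Definition _ k :=
  GRing.Lmodule.copy (stens k) {ffun midx k * midx k -> M}.

Definition tens k (x : 'I_k -> 'M[F]_N) (y : M) : stens k :=
  [ffun IJ : midx k * midx k => (\prod_a x a (IJ.1 a) (IJ.2 a)) *: y].

Definition stens_one k : stens k := tens (fun _ => 1%:M) 1.

Definition stens_mul k (X Y : stens k) : stens k :=
  [ffun IL : midx k * midx k => \sum_(J : midx k)
     (-1) ^+ koszul (mdeg IL.1 J) (mdeg J IL.2) *: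
     (rq_twist (\sum_b mdeg J IL.2 b) (X (IL.1, J)) * Y (J, IL.2))].

Section Ring.
Variable k : nat.
Implicit Types (X Y : stens k) (p q : 'I_k -> bool).

Lemma koszul_addl p p' q : (-1) ^+ koszul (fun a => p a (+) p' a) q =
  (-1) ^+ koszul p q * (-1) ^+ koszul p' q :> F.
Proof.
rewrite -exprD -big_split /= -[LHS]signr_odd -[RHS]signr_odd; congr (_ ^+ _).
rewrite /koszul; congr nat_of_bool; elim/big_rec2: _ => // a x y _.
rewrite !oddD => ->; congr (_ (+) _); rewrite -oddD -big_split /=.
elim/big_rec2: _ => // b z w _; rewrite !oddD => ->; congr (_ (+) _).
by case: (p a); case: (p' a); case: (q b).
Qed.

Lemma koszul_addr p q q' : (-1) ^+ koszul p (fun a => q a (+) q' a) =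
  (-1) ^+ koszul p q * (-1) ^+ koszul p q' :> F.
Proof.
rewrite -exprD -big_split /= -[LHS]signr_odd -[RHS]signr_odd; congr (_ ^+ _).
rewrite /koszul; congr nat_of_bool; elim/big_rec2: _ => // a x y _.
rewrite !oddD => ->; congr (_ (+) _); rewrite -oddD -big_split /=.
elim/big_rec2: _ => // b z w _; rewrite !oddD => ->; congr (_ (+) _).
by case: (p a); case: (q b); case: (q' b).
Qed.

Lemma mdeg_add (I J K : midx k) :
  mdeg I K = fun a => mdeg I J a (+) mdeg J K a.
Proof.
apply: funext => a; rewrite /mdeg.
by case: (par (I a)); case: (par (J a)); case: (par (K a)).
Qed.

Lemma odd_sum_addb p q :
  odd (\sum_b (p b (+) q b)) = odd (\sum_b p b + \sum_b q b).
Proof.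
rewrite -big_split /=; elim/big_rec2: _ => // b x y _; rewrite !oddD => ->.
by congr (_ (+) _); case: (p b); case: (q b).
Qed.

Fact stens_mulA : associative (@stens_mul k).
Proof.
move=> X Y Z; apply/ffunP => -[I L]; rewrite !ffunE /=.
transitivity (\sum_J \sum_K
    ((-1) ^+ koszul (mdeg I J) (mdeg J L) *
     (-1) ^+ koszul (mdeg J K) (mdeg K L)) *:
    (rq_twist (\sum_b mdeg J L b) (X (I, J)) *
     (rq_twist (\sum_b mdeg K L b) (Y (J, K)) * Z (K, L)))).
  apply: eq_bigr => J _; rewrite ffunE mulr_sumr scaler_sumr.
  by apply: eq_bigr => K _; rewrite /= -scalerAr scalerA.
rewrite exchange_big; apply: eq_bigr => K _ /=.
rewrite ffunE linear_sum mulr_suml scaler_sumr; apply: eq_bigr => J _ /=.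
rewrite linearZ /= -scalerAl scalerA rq_twistM mulrA -rq_twistD.
congr (_ *: (_ * _ * _)).
  rewrite (mdeg_add J K L) koszul_addr (mdeg_add I J K) koszul_addl.
  by rewrite -mulrA mulrC.
rewrite rq_twist_odd [RHS]rq_twist_odd; congr (rq_twist (nat_of_bool _) _).
by rewrite (mdeg_add J K L) odd_sum_addb addnC.
Qed.

Lemma stens_oneE (I J : midx k) : stens_one k (I, J) = (I == J)%:R.
Proof.
rewrite ffunE /=; have [<-|neIJ] := eqVneq I J.
  by rewrite big1 ?scale1r // => a _; rewrite mxE eqxx.
have [a neqa] : exists a, I a != J a.
  apply/existsP; apply: contraNT neIJ; rewrite negb_exists => /forallP H.
  by apply/eqP/ffunP => a; apply/eqP; have := H a; rewrite negbK.
by rewrite (bigD1 a) //= mxE (negbTE neqa) mul0r scale0r.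
Qed.

Lemma mdegxx (I : midx k) a : mdeg I I a = false.
Proof. exact: addbb. Qed.

Fact stens_mul1x : left_id (stens_one k) (@stens_mul k).
Proof.
move=> X; apply/ffunP => -[I L]; rewrite ffunE /= (bigD1 I) //= [X in _ + X]big1 ?addr0.
  rewrite stens_oneE eqxx rq_twist1 mul1r /koszul big1 ?scale1r // => a _.
  by rewrite big1 // => b _; rewrite mdegxx.
by move=> J neJ; rewrite stens_oneE eq_sym (negbTE neJ) linear0 mul0r scaler0.
Qed.

Fact stens_mulx1 : right_id (stens_one k) (@stens_mul k).
Proof.
move=> X; apply/ffunP => -[I L]; rewrite ffunE /= (bigD1 L) //= [X in _ + X]big1 ?addr0.
  rewrite stens_oneE eqxx mulr1 [\sum_b _]big1 => [|b _]; last by rewrite mdegxx.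
  rewrite /koszul big1 ?scale1r // => a _.
  by rewrite big1 // => b _; rewrite mdegxx muln0.
by move=> J neJ; rewrite stens_oneE (negbTE neJ) mulr0 scaler0.
Qed.

Fact stens_mulDl : left_distributive (@stens_mul k) +%R.
Proof.
move=> X Y Z; apply/ffunP => -[I L]; rewrite !ffunE -big_split.
by apply: eq_bigr => J _; rewrite /= ffunE linearD mulrDl scalerDr.
Qed.

Fact stens_mulDr : right_distributive (@stens_mul k) +%R.
Proof.
move=> X Y Z; apply/ffunP => -[I L]; rewrite !ffunE -big_split.
by apply: eq_bigr => J _; rewrite /= ffunE mulrDr scalerDr.
Qed.

HB.instance Definition _ := GRing.Zmodule_isPzRing.Build (stens k)
  stens_mulA stens_mul1x stens_mulx1 stens_mulDl stens_mulDr.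

(* The sign rule for the product of decomposable tensors. *)
Lemma tensM (x x' : 'I_k -> 'M[F]_N) (y y' : M) (p p' : 'I_k -> bool) (d : bool) :
  (forall a i j, x a i j != 0 -> par i (+) par j = p a) ->
  (forall a i j, x' a i j != 0 -> par i (+) par j = p' a) ->
  rq_homog d y ->
  tens x y * tens x' y' =
  (-1) ^+ (koszul p p' + d * \sum_a p' a) *:
    tens (fun a => x a *m x' a) (y * y').
Proof.
move=> hx hx' hy; apply/ffunP => -[I L]; rewrite !ffunE /=.
pose f a j := x a (I a) j * x' a j (L a).
have -> : \prod_a (x a *m x' a) (I a) (L a) =
    \sum_(J : midx k) \prod_a (x a (I a) (J a) * x' a (J a) (L a)).
  under eq_bigr do rewrite mxE.
  exact: (bigA_distr_bigA f).
rewrite scaler_suml scaler_sumr; apply: eq_bigr => J _.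
rewrite !ffunE /= linearZ /= -scalerAl -scalerAr (rq_twist_homog _ hy) -scalerAl.
rewrite !scalerA big_split /=.
have [-> | nz] := eqVneq (\prod_a x a (I a) (J a)) 0; first by rewrite !(mulr0, mul0r).
have [-> | nz'] := eqVneq (\prod_a x' a (J a) (L a)) 0; first by rewrite !(mulr0, mul0r).
have -> : mdeg I J = p.
  by apply: funext => a; apply: (hx a); move/prodf_neq0: nz; apply.
have -> : mdeg J L = p'.
  by apply: funext => a; apply: (hx' a); move/prodf_neq0: nz'; apply.
congr (_ *: _); rewrite exprD [(d * _)%N]mulnC -!mulrA; congr (_ * _).
by rewrite mulrC -mulrA mulrC -!mulrA.
Qed.

End Ring.

(* str_(1, ..., k) *)
Definition strk k (X : stens k) : M :=
  \sum_(I : midx k) (-1) ^+ (\sum_a par (I a)) *: X (I, I).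

Lemma strk_tens k (x : 'I_k -> 'M[F]_N) (y : M) :
  strk (tens x y) = (\prod_a mxstr (x a)) *: y.
Proof.
rewrite /mxstr (bigA_distr_bigA (fun a i => (-1) ^+ par i * x a i i)) scaler_suml.
by apply: eq_bigr => I _; rewrite ffunE /= scalerA big_split /= -prodrXr.
Qed.

(* Z_a, with the position a counted from 0. *)
Definition Zpos k (a : 'I_k) : stens k :=
  \sum_(i : 'I_N) \sum_(j : 'I_N)
    tens (fun b => if b == a then delta_mx i j else 1%:M)
      ((-1) ^+ (par i * par j + par j) *: rq_gen F i j).

Definition Ptransp k (a b : 'I_k) : stens k :=
  \sum_(i : 'I_N) \sum_(j : 'I_N) (-1) ^+ par j *:
    tens (fun c => if c == a then delta_mx i j
                   else if c == b then delta_mx j i else 1%:M) 1.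

(* s sends v_(J 0) (x) ... (x) v_(J (k-1)) to (-1)^(perm_inv s J) times
   v_(I 0) (x) ... (x) v_(I (k-1)) with I := perm_midx s J, the sign counting
   the pairs of odd vectors whose order is reversed. *)
Definition perm_midx k (s : 'S_k) (J : midx k) : midx k :=
  [ffun a => J ((s^-1)%g a)].

Definition perm_inv k (s : 'S_k) (J : midx k) : nat :=
  \sum_(a < k) \sum_(b < k | (a < b)%N && (s b < s a)%N) par (J a) * par (J b).

(* The representing element of (End C^(m|n))^((x) k). The second sign accounts
   for the action of decomposable operators on decomposable vectors:
   (e_(I 0, J 0) (x) ... (x) e_(I (k-1), J (k-1))) (v_(J 0) (x) ... (x) v_(J (k-1)))
   = (-1)^(koszul (mdeg I J) (par \o J)) v_(I 0) (x) ... (x) v_(I (k-1)). *)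
Definition Pperm k (s : 'S_k) : stens k :=
  [ffun IJ : midx k * midx k =>
    if IJ.1 == perm_midx s IJ.2 then
      (-1) ^+ (perm_inv s IJ.2 +
               koszul (mdeg IJ.1 IJ.2) (fun a => par (IJ.2 a))) *: 1
    else 0].

Section PermRepresentation.
Variable k : nat.
Implicit Types (s t : 'S_k) (J : midx k).

Lemma odd_eq_sgn (d e : nat) : odd d = odd e -> (-1) ^+ d = (-1) ^+ e :> F.
Proof. by move=> h; rewrite -[LHS]signr_odd h signr_odd. Qed.

Lemma perm_midxM s t J : perm_midx (t * s) J = perm_midx s (perm_midx t J).
Proof. by apply/ffunP => a; rewrite !ffunE invMg permM. Qed.

Lemma perm_inv_symm (Q : rel 'I_k) (c : 'I_k -> 'I_k -> nat) :
  (forall a b, c a b = c b a) -> (forall a, Q a a = false) ->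
  (\sum_(a < k) \sum_(b < k | Q a b) c a b =
   \sum_(a < k) \sum_(b < k | (a < b)%N) (Q a b + Q b a) * c a b)%N.
Proof.
move=> cC Qxx.
have -> : (\sum_(a < k) \sum_(b < k | Q a b) c a b = \sum_(a < k) \sum_(b < k | (a < b)%N) Q a b * c a b
    + \sum_(a < k) \sum_(b < k | (b < a)%N) Q a b * c a b)%N.
  rewrite -big_split; apply: eq_bigr => a _ /=.
  rewrite [in RHS]big_mkcond [X in (_ + X)%N]big_mkcond -big_split big_mkcond /=.
  apply: eq_bigr => b _; case: ltngtP => [lab|lba|/val_inj ->].
  - by rewrite addn0; case: ifP; rewrite ?mul1n ?mul0n.
  - by rewrite add0n; case: ifP; rewrite ?mul1n ?mul0n.
  - by rewrite Qxx.
have -> : (\sum_(a < k) \sum_(b < k | (b < a)%N) Q a b * c a b =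
           \sum_(a < k) \sum_(b < k | (a < b)%N) Q b a * c a b)%N.
  rewrite (exchange_big_dep predT) //=; apply: eq_bigr => b _.
  by apply: eq_bigr => a _; rewrite cC.
rewrite -big_split; apply: eq_bigr => a _ /=; rewrite -big_split.
by apply: eq_bigr => b _; rewrite /= mulnDl.
Qed.

Lemma perm_inv_cocycle s t J :
  odd (perm_inv (t * s) J) = odd (perm_inv s (perm_midx t J) + perm_inv t J).
Proof.
pose c (a b : 'I_k) := (par (J a) * par (J b))%N.
have -> : perm_inv s (perm_midx t J) =
  (\sum_(a < k) \sum_(b < k | (t a < t b)%N && (s (t b) < s (t a))%N) c a b)%N.
  rewrite /perm_inv (reindex_inj (@perm_inj _ t)) /=; apply: eq_bigr => a _.
  rewrite (reindex_inj (@perm_inj _ t)) /=; apply: eq_bigr => b _.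
  by rewrite !ffunE !permK.
rewrite (@perm_inv_symm (fun a b => (t a < t b)%N && (s (t b) < s (t a))%N)) //.
- rewrite /perm_inv -big_split; elim/big_rec2: _ => // a x y _.
  rewrite !oddD => ->; congr (_ (+) _); rewrite -oddD.
  rewrite big_mkcondr [X in odd (_ + X)]big_mkcondr -big_split /=.
  elim/big_rec2: _ => // b z w lab; rewrite !oddD => ->; congr (_ (+) _).
  have neq (u : 'S_k) : (u a < u b)%N = ~~ (u b < u a)%N.
    case: ltngtP => // e.
    by rewrite (perm_inj (val_inj e)) ltnn in lab.
  have := neq t; have := neq (t * s)%g; rewrite !permM => -> ->.
  by rewrite -/(c a b); case: (t b < t a)%N; case: (s (t b) < s (t a))%N => /=;
    rewrite ?mul1n ?addbb ?addbF.
- by move=> a b; rewrite /c mulnC.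
by move=> a; rewrite !ltnn.
Qed.

Lemma Pperm1 : Pperm (1 : 'S_k) = 1.
Proof.
apply/ffunP => -[I J]; rewrite [in RHS]/1 /= stens_oneE ffunE /=.
have -> : perm_midx 1 J = J by apply/ffunP => a; rewrite ffunE invg1 perm1.
case: eqP => // ->; rewrite /perm_inv big1 => [|a _]; last first.
  by rewrite big_pred0 // => b; rewrite !perm1; case: ltngtP.
rewrite /koszul big1 ?scale1r // => a _.
by rewrite big1 // => b _; rewrite mdegxx.
Qed.

Lemma PpermM s t : Pperm (t * s) = Pperm s * Pperm t.
Proof.
apply/ffunP => -[I L]; rewrite [LHS]ffunE [RHS]ffunE /= (bigD1 (perm_midx t L)) //=.
rewrite [X in _ = _ + X]big1 ?addr0 => [|J neJ]; last first.
  by rewrite [Pperm t _]ffunE /= (negbTE neJ) mulr0 scaler0.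
rewrite [Pperm t _]ffunE /= eqxx [Pperm s _]ffunE /= perm_midxM.
set J := perm_midx t L; case: eqP => [_|_]; last by rewrite linear0 mul0r scaler0.
rewrite linearZ /= rq_twist1 -scalerAl mul1r !scalerA; congr (_ *: _).
rewrite -[LHS]signr_odd oddD perm_inv_cocycle -oddD signr_odd !exprD.
rewrite [mdeg I L](mdeg_add I J L) koszul_addl.
have -> : (fun a => par (J a)) = (fun a => mdeg J L a (+) par (L a)).
  by apply: funext => a; rewrite /mdeg -addbA addbb addbF.
rewrite (koszul_addr (mdeg I J) (mdeg J L) (fun a => par (L a))).
set x := _ ^+ perm_inv s _; set y := _ ^+ perm_inv t _.
set u := _ ^+ koszul (mdeg I J) (mdeg J L).
have uu : u * u = 1 by rewrite -expr2 sqrr_sign.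
set v := _ ^+ _; set w := _ ^+ _.
transitivity (u * u * (x * y * (v * w))); first by rewrite uu mul1r.
by rewrite !mulrA [RHS](ACl (1*3*2*5*4*6)).
Qed.

End PermRepresentation.

Lemma PtranspE k (a b : 'I_k) (I J : midx k) : a != b ->
  Ptransp a b (I, J) =
  if I == perm_midx (tperm a b) J then (-1) ^+ par (J a) *: 1 else 0.
Proof.
move=> neab; rewrite /Ptransp sum_ffunE (bigD1 (I a)) //= sum_ffunE.
rewrite (bigD1 (J a)) //= !ffunE [X in _ + X + _]big1 => [|j nej]; last first.
  rewrite !ffunE (bigD1 a) //= eqxx mxE (eq_sym _ j) (negbTE nej) andbF.
  by rewrite mul0r scale0r scaler0.
rewrite [X in _ + _ + X]big1 => [|i nei]; last first.
  rewrite sum_ffunE big1 // => j _; rewrite !ffunE (bigD1 a) //= eqxx mxE.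
  by rewrite (eq_sym _ i) (negbTE nei) mul0r scale0r scaler0.
rewrite !addr0; have [-> | neI] := eqVneq I; last first.
  have [c neIc] : exists c, I c != perm_midx (tperm a b) J c.
    apply/existsP; apply: contraNT neI; rewrite negb_exists => /forallP H.
    by apply/eqP/ffunP => c; apply/eqP; have := H c; rewrite negbK.
  have vanish d : (if d == a then delta_mx (I a) (J a) else
      if d == b then delta_mx (J a) (I a) else 1%:M : 'M[F]_N) (I d) (J d) = 0 ->
    (\prod_e (if e == a then delta_mx (I a) (J a) else
      if e == b then delta_mx (J a) (I a) else 1%:M : 'M[F]_N) (I e) (J e)) = 0.
    by move=> h; rewrite (bigD1 d) //= h mul0r.
  suff [d hd] : exists d, (if d == a then delta_mx (I a) (J a) else
      if d == b then delta_mx (J a) (I a) else 1%:M : 'M[F]_N) (I d) (J d) = 0.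
    by rewrite (vanish _ hd) scale0r scaler0.
  move: neIc; rewrite ffunE tpermV; case: tpermP => [->|->|/eqP nea /eqP neb] ne.
  - by exists b; rewrite eq_sym (negbTE neab) eqxx mxE (eq_sym (J b)) (negbTE ne) andbF.
  - by exists b; rewrite eq_sym (negbTE neab) eqxx mxE (negbTE ne).
  - by exists c; rewrite (negbTE nea) (negbTE neb) mxE (negbTE ne).
rewrite big1 ?scale1r // => c _; rewrite !ffunE !tpermV tpermL.
case: (tpermP a b c) => [->|->|/eqP nea /eqP neb].
- by rewrite eqxx mxE !eqxx.
- by rewrite eq_sym (negbTE neab) eqxx mxE !eqxx.
- by rewrite (negbTE nea) (negbTE neb) mxE eqxx.
Qed.

Lemma Pperm_tperm k (a b : 'I_k) : (a < b)%N -> Pperm (tperm a b) = Ptransp a b.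
Proof.
move=> lab; have neab : a != b by rewrite -val_eqE neq_ltn lab.
apply/ffunP => -[I J]; rewrite PtranspE // ffunE /=.
case: eqP => [->|//]; congr (_ *: _); apply: odd_eq_sgn.
pose j (c : 'I_k) : nat := par (J c).
have -> : perm_inv (tperm a b) J =
  (j a * \sum_(d < k | (a < d <= b)%N) j d + j b * \sum_(c < k | (a < c < b)%N) j c)%N.
  rewrite /perm_inv (bigD1 a) //= big_distrr /=; congr (_ + _)%N.
    apply: eq_bigl => d; rewrite tpermL; case: tpermP => [->|->|].
    - by rewrite !ltnn.
    - by rewrite lab leqnn.
    - by move=> _ /eqP; rewrite -val_eqE [(d <= b)%N]leq_eqVlt => /negbTE ->.
  rewrite big_distrr /= [RHS]big_mkcond [LHS]big_mkcond /=; apply: eq_bigr => c _.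
  have [->|neca] := eqVneq c a; first by rewrite ltnn.
  rewrite -/(j c); move: neca; case: tpermP => [->|->|/eqP nea /eqP neb].
  - by rewrite eqxx.
  - move=> _; rewrite ltnn andbF big_pred0 // => d; case: tpermP => [->|->|_ _].
    + by rewrite ltnNge (ltnW lab).
    + by rewrite ltnn.
    + by apply/negP => /andP[h /ltn_trans /(_ lab)]; rewrite ltnNge (ltnW h).
  - move=> _; case: ifP => [/andP[lac lcb]|h].
      rewrite (big_pred1 b) => [|d]; first by rewrite mulnC.
      rewrite /=; case: tpermP => [->|->|/eqP neda /eqP nedb].
      + by rewrite ltnNge (ltnW lac) (negbTE neab).
      + by rewrite lcb lac eqxx.
      + by rewrite (negbTE nedb); case: ltngtP.
    rewrite big_pred0 // => d; case: tpermP => [->|->|_ _].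
    + by apply/negP => /andP[h1 h2]; have := ltn_trans h2 h1;
        rewrite ltnNge (ltnW lab).
    + by rewrite andbC h.
    + by case: ltngtP.
have -> : koszul (mdeg (perm_midx (tperm a b) J) J) (fun c => par (J c)) =
  ((par (J a) (+) par (J b)) * (\sum_(d < k | (d < a)%N) j d + \sum_(d < k | (d < b)%N) j d))%N.
  rewrite /koszul (bigD1 a) //= [X in (_ + X)%N](bigD1 b) /=; last by rewrite eq_sym.
  rewrite [X in (_ + (_ + X))%N]big1 => [|c]; last first.
    rewrite ![c == _]eq_sym => /andP[nea neb].
    rewrite big1 // => d _; rewrite /mdeg ffunE tpermV tpermD //.
    by rewrite addbb.
  rewrite addn0 -!big_distrr /= /mdeg !ffunE !tpermV tpermL tpermR mulnDr.
  by rewrite [par (J b) (+) _]addbC.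
have -> : (\sum_(d < k | (d < b)%N) j d =
   \sum_(d < k | (d < a)%N) j d + (j a + \sum_(d < k | (a < d < b)%N) j d))%N.
  rewrite (bigID (fun d : 'I_k => (d < a)%N)) /=; congr (_ + _)%N.
    by apply: eq_bigl => d; case: (ltnP d a) => h; rewrite ?andbF // (ltn_trans h lab).
  rewrite (bigD1 a) /= ?lab ?ltnn //; congr (_ + _)%N; apply: eq_bigl => d.
  by rewrite -val_eqE /=; case: (ltngtP d a); rewrite ?andbT ?andbF.
have -> : (\sum_(d < k | (a < d <= b)%N) j d = j b + \sum_(d < k | (a < d < b)%N) j d)%N.
  rewrite (bigD1 b) /= ?lab ?leqnn //; congr (_ + _)%N; apply: eq_bigl => d.
  by rewrite -val_eqE /=; case: (ltngtP d b); rewrite ?andbT ?andbF.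
rewrite !addnA addnn !(oddD, oddM, odd_double) /j.
set S := odd (\sum_(d < k | _) _); case: S;
  by case: (par (J a)); case: (par (J b)).
Qed.

Definition Hsym k : stens k := k`!%:R^-1 *: \sum_(s : 'S_k) Pperm s.

Definition Asym k : stens k :=
  k`!%:R^-1 *: \sum_(s : 'S_k) (-1) ^+ s *: Pperm s.

End TensorSuperalgebra.

(* Main.v *)
Require Import Defs.
From HB Require Import structures.
From mathcomp Require Import all_boot all_order all_algebra.
From mathcomp Require Import boolp fingroup perm.
From mathcomp Require Import reals complex.

(* Let E(u) and H(u) be the generating series of str A_k Z_1 ... Z_k and
   str H_k Z_1 ... Z_k.

   Making the tensor superalgebra act on (C^(m|n))^((x) k) (x) M turns these
   supertraces into sums over words J of superpermanents (for H_k) and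
   superdeterminants (for A_k) with rows and columns J. The defining relations
   make these symmetric or skew in the rows, so that taking the supertrace over
   all tensor factors but one and expanding along a row gives matrix
   Cayley-Hamilton identities. Writing Z(u) = 1 + uZ, these imply
   - Newton's identities E' = E str(Z Z(u)^-1) and H' = str(Z Z(-u)^-1) H,
     whence E(-u) H(u) = 1 because (E(-u) H(u))' = 0;
   - deletion formulas for the series E_p of Z with the row and column p removed:
     E_p = E (Z(u)^-1)_pp for p even, E = E_p (Z(u)^-1)_pp for p odd.

   The matrix Z(u)^-1 satisfies the same quadratic relations as Z(u), so Cramer's
   rule holds for the column determinant of the even block of Z(u) and for the row
   determinant of the odd block of Z(u)^-1. Removing indices one at a time, the
   two factors of Ber Z(u) obey the same recursion as E, hence Ber Z(u) = E. *)

Set Implicit Arguments.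
Unset Strict Implicit.
Unset Printing Implicit Defensive.

Import GRing.Theory.
Local Open Scope ring_scope.
Local Open Scope complex_scope.

(** * Superpermanents and superdeterminants *)

Section SuperImmanant.
Variables (I : finType) (par : I -> bool) (S : pzRingType) (e : bool).
Implicit Types (p q r c x : I) (J K L A B : seq I) (w : I -> I -> S).
Implicit Types (f : seq I -> S).

(** Signs are booleans combined by [addb], so that every sign identity reduces to a case split on
    parities. *)
Definition sg (b : bool) (x : S) : S := if b then - x else x.

Lemma sgA a b (x : S) : sg a (sg b x) = sg (a (+) b) x.
Proof. by case: a b => -[]; rewrite /sg /= ?opprK. Qed.
Lemma sg_false (x : S) : sg false x = x.
Proof. by []. Qed.
Lemma sg0 b : sg b 0 = 0.
Proof. by case: b; rewrite /sg ?oppr0. Qed.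
Lemma sgD b (x y : S) : sg b (x + y) = sg b x + sg b y.
Proof. by case: b; rewrite /sg ?opprD. Qed.
Lemma sgMr b (x y : S) : x * sg b y = sg b (x * y).
Proof. by case: b; rewrite /sg ?mulrN. Qed.
Lemma sgMl b (x y : S) : sg b x * y = sg b (x * y).
Proof. by case: b; rewrite /sg ?mulNr. Qed.
Lemma sgMn b (x : S) k : sg b x *+ k = sg b (x *+ k).
Proof. by case: b; rewrite /sg ?mulNrn. Qed.
Lemma sg_sum b (J : Type) (r : seq J) (P : pred J) (F : J -> S) :
  sg b (\sum_(i <- r | P i) F i) = \sum_(i <- r | P i) sg b (F i).
Proof. by case: b; rewrite /sg ?sumrN. Qed.
Lemma sgE b (x : S) : sg b x = (-1) ^+ b * x.
Proof. by rewrite mulr_sign. Qed.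

Definition wpar J : bool := foldr (fun c b => par c (+) b) false J.

Lemma wpar_cat A B : wpar (A ++ B) = wpar A (+) wpar B.
Proof. by elim: A => //= c A ->; rewrite addbA. Qed.

(* For e = false these are the matrix entries of (1 - P) Z_1 Z_2 (1 + P) = 0 acting
   on C^(m|n) (x) C^(m|n) (x) M; a matrix satisfies them if and only if its transpose
   over the converse ring satisfies them for e = true. *)
Definition manin w := forall p r c x,
  sg (par c && par r) (w p c * w r x) +
    sg (e (+) (par x && (par r (+) par c))) (w p x * w r c) =
  sg (e (+) (par p && par r) (+) (par c && par p)) (w r c * w p x) +
    sg ((par p && par r) (+) (par x && (par p (+) par c))) (w r x * w p c).

Section Expansion.
Variable w : I -> I -> S.

(* The sum over the positions i of J of w p J_i * f (J without J_i), with the sign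
   (-1)^(e i + |J_i| (d + |J_0| + ... + |J_(i-1)|)). *)
Fixpoint expand p (d : bool) f J : S :=
  if J is c :: J' then
    sg (par c && d) (w p c * f J') +
    sg e (expand p (d (+) par c) (fun K => f (c :: K)) J')
  else 0.

(* The matrix entry (L, J) of k! Z_1 ... Z_k H_k for e = false (a superpermanent);
   over the converse ring and for e = true, a superdeterminant. *)
Fixpoint superimm L J : S :=
  if L is p :: L' then
    sg (par p && wpar L') (expand p (wpar L') (superimm L') J)
  else (nilp J)%:R.

Lemma eq_expand p d f f' J : (forall K, f K = f' K) ->
  expand p d f J = expand p d f' J.
Proof.
elim: J d f f' => [//|c J IH] d f f' ff' /=; rewrite ff'; congr (_ + sg _ _).
by apply: IH => K; apply: ff'.
Qed.

Lemma expandD p d f f' J :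
  expand p d (fun K => f K + f' K) J = expand p d f J + expand p d f' J.
Proof.
elim: J d f f' => [|c J IH] d f f' /=; first by rewrite addr0.
by rewrite !IH mulrDr !sgD addrACA.
Qed.

Lemma expand_sg p d b f J :
  expand p d (fun K => sg b (f K)) J = sg b (expand p d f J).
Proof.
elim: J d f => [|c J IH] d f /=; first by rewrite sg0.
by rewrite IH sgMr sgD !sgA !(addbC b).
Qed.

(** Both sides collect terms in which exactly one of the rows [p] and [r] takes a column [c]
    standing before [J]. By induction on [J]: the terms whose other row takes the first letter [x]
    of [J] form the relation [manin] for the columns [c] and [x]. *)
Lemma expand_pair (w_manin : manin w) c p r d f J :
  sg (par c && par r) (w p c * expand r d f J) +
    sg e (expand p (d (+) par r (+) par c) (fun K => w r c * f K) J) =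
  sg (e (+) (par p && par r) (+) (par c && par p)) (w r c * expand p d f J) +
    sg (par p && par r) (expand r (d (+) par p (+) par c) (fun K => w p c * f K) J).
Proof.
elim: J d f => [|x J IH] d f /=; first by rewrite !mulr0 !sg0.
have := IH (d (+) par x) (fun K => f (x :: K)).
rewrite !(addbAC d (par x)) !(addbAC (_ (+) par r) (par x)).
rewrite !(addbAC (_ (+) par p) (par x)).
set E1 := expand r _ _ J; set E2 := expand p _ _ J; set E3 := expand p _ _ J.
set E4 := expand r _ _ J; clearbody E1 E2 E3 E4.
move/(congr1 (sg e)); rewrite !sgD !sgA => IHJ.
have /(congr1 (fun y => sg (par x && d) (y * f J))) := w_manin p r c x.
rewrite !mulrDl !sgMl !sgD !sgA -!mulrA => M.
rewrite !mulrDr !sgMr !sgD !sgA.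
rewrite [LHS](AC (2*2) ((1*3)*(2*4))) [RHS](AC (2*2) ((1*3)*(2*4))) /=.
congr (_ + _).
  move: M.
  by case: (par x); case: (par c); case: (par p); case: (par r); case: (d); case: (e).
by move: IHJ; case: (e); case: (par c); case: (par p); case: (par r).
Qed.

(** Split by which rows take the first column [c]: if exactly one does, [expand_pair] applies; if
    neither does, induction. *)
Lemma expand_swap (w_manin : manin w) p r d f J :
  expand p (d (+) par r) (expand r d f) J =
  sg (e (+) (par p && par r)) (expand r (d (+) par p) (expand p d f) J).
Proof.
elim: J d f => [|c J IH] d f /=; first by rewrite sg0.
rewrite !expandD !expand_sg.
set f1 := fun K => f (c :: K).
have IHf : expand p (d (+) par r (+) par c) (expand r (d (+) par c) f1) J =
  sg (e (+) (par p && par r))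
  (expand r (d (+) par p (+) par c) (expand p (d (+) par c) f1) J).
  by rewrite !(addbAC _ _ (par c)) IH.
rewrite {}IHf !sgD !sgA !addrA; congr (_ + _); last first.
  by congr (sg _ _); case: (e); case: (par p && par r).
have /(congr1 (sg (par c && d))) := expand_pair w_manin c p r d f J.
rewrite !sgD !sgA.
by case: (par c); case: (par p); case: (par r); case: (d); case: (e).
Qed.

Definition sg_swap p r : bool := e (+) (par p && par r).
Definition sg_move c A : bool := (e && odd (size A)) (+) (par c && wpar A).

Lemma superimm_swapl (w_manin : manin w) p r L J :
  superimm (p :: r :: L) J = sg (sg_swap p r) (superimm (r :: p :: L) J).
Proof.
rewrite /= !expand_sg (addbC (par r)) (addbC (par p)) expand_swap // !sgA.
congr (sg _ _); rewrite /sg_swap.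
by case: (par p); case: (par r); case: (wpar L); case: (e).
Qed.

Lemma superimm_movel (w_manin : manin w) A c B J :
  superimm (A ++ c :: B) J = sg (sg_move c A) (superimm (c :: A ++ B) J).
Proof.
elim: A J => [|a A IH] J; first by rewrite /sg_move andbF andbF sg_false.
rewrite [LHS]/= (eq_expand _ _ _ IH) expand_sg sgA.
rewrite -[(a :: A) ++ B]/(a :: A ++ B) superimm_swapl // sgA /= !expand_sg.
rewrite !wpar_cat /= !sgA (addbCA (wpar A)); congr (sg _ _).
rewrite /sg_move /sg_swap /=.
by case: (par a); case: (par c); case: (wpar A); case: (wpar B); case: (e); case: (odd _).
Qed.

Definition swap_sym f := forall A p r B,
  f (A ++ p :: r :: B) = sg (sg_swap p r) (f (A ++ r :: p :: B)).

(** Exchanging two adjacent columns matches the term picking one with the term picking the other;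
    when the picked column lies elsewhere, the sign comes from [f]. *)
Lemma expand_swap_sym p d f : swap_sym f -> swap_sym (expand p d f).
Proof.
move=> fS A; elim: A d f fS => [|a A IH] d f fS c r B /=; last first.
  rewrite (fS A) IH; first by rewrite sgD sgMr !sgA !(addbC (sg_swap _ _)).
  by move=> A' c' r' B'; rewrite -!cat_cons fS.
rewrite (@eq_expand _ _ _ (fun K => sg (sg_swap c r) (f (r :: c :: K)))); last first.
  by move=> K; exact: (fS [::]).
rewrite expand_sg !sgD !sgA !addrA (addbAC d).
congr (_ + _); last by congr (sg _ _); case: (e); case: (sg_swap _ _).
rewrite addrC; congr (_ + _); congr (sg _ _); rewrite /sg_swap;
  by case: (par c); case: (par r); case: (d); case: (e).
Qed.

Lemma superimm_swap_sym L : swap_sym (superimm L).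
Proof.
elim: L => [|p L IH] A c r B /=; first by case: A => [|? ?] /=; rewrite sg0.
by rewrite (expand_swap_sym p _ IH) !sgA addbC.
Qed.

Lemma swap_sym_move f A c B : swap_sym f ->
  f (A ++ c :: B) = sg (sg_move c A) (f (c :: A ++ B)).
Proof.
move=> fS; elim: A f fS => [|a A IH] f fS; first by rewrite /sg_move andbF andbF sg_false.
have /IH fa : swap_sym (fun K => f (a :: K)).
  by move=> A' p r B'; rewrite -!cat_cons fS.
rewrite /= fa (fS [::]) sgA /=; congr (sg _ _); rewrite /sg_move /sg_swap /=.
by case: (par a); case: (par c); case: (wpar A); case: (e); case: (odd _).
Qed.

Lemma superimm_mover L A c B :
  superimm L (A ++ c :: B) = sg (sg_move c A) (superimm L (c :: A ++ B)).
Proof. exact/swap_sym_move/superimm_swap_sym. Qed.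

Hypothesis S_tf : forall x : S, x + x = 0 -> x = 0.

(** Bringing the two copies of [p] together and exchanging them changes the sign, since
    [sg_swap p p] is [e (+) par p]; hence twice the value is zero. *)
Lemma superimm_dupl (w_manin : manin w) p L J : e (+) par p -> p \in L ->
  superimm (p :: L) J = 0.
Proof.
move=> ep /path.splitPr [A B]; rewrite -cat1s catA.
have -> : superimm (([:: p] ++ A) ++ p :: B) J =
  sg (sg_move p ([:: p] ++ A)) (superimm (p :: p :: A ++ B) J).
  by rewrite superimm_movel.
have /S_tf -> : superimm (p :: p :: A ++ B) J + superimm (p :: p :: A ++ B) J = 0.
  by rewrite {1}superimm_swapl // /sg_swap andbb ep /sg addNr.
by rewrite sg0.
Qed.

(* Sum over the decompositions J = A ++ c :: B of phi c (A ++ B). *)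
Fixpoint picks (phi : I -> seq I -> S) J : S :=
  if J is c :: K then phi c K + picks (fun b M => phi b (c :: M)) K else 0.

Lemma eq_picks phi psi J :
  (forall c K, par c (+) wpar K = wpar J -> phi c K = psi c K) ->
  picks phi J = picks psi J.
Proof.
elim: J phi psi => //= c K IH phi psi E; rewrite E //; congr (_ + _).
by apply: IH => b M eb; apply: E; rewrite /= -eb addbCA.
Qed.

Lemma picks_sg b phi J : picks (fun c K => sg b (phi c K)) J = sg b (picks phi J).
Proof. by elim: J phi => [|c J IH] phi /=; rewrite ?sg0 // IH sgD. Qed.

Fixpoint wsum k f : S :=
  if k is k'.+1 then \sum_c wsum k' (fun K => f (c :: K)) else f [::].

Lemma eq_wsum k f f' : (forall J, size J = k -> f J = f' J) -> wsum k f = wsum k f'.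
Proof.
elim: k f f' => [|k IH] f f' E /=; first exact: E.
by apply: eq_bigr => c _; apply: IH => K sK; apply: E; rewrite /= sK.
Qed.

Lemma wsumD k f f' : wsum k (fun J => f J + f' J) = wsum k f + wsum k f'.
Proof.
elim: k f f' => [|k IH] f f' //=.
by rewrite -big_split; apply: eq_bigr => c _; rewrite IH.
Qed.

Lemma wsumMl k (x : S) f : wsum k (fun J => x * f J) = x * wsum k f.
Proof.
elim: k f => [|k IH] f //=.
by rewrite mulr_sumr; apply: eq_bigr => c _; rewrite IH.
Qed.

Lemma wsum_sg k b f : wsum k (fun J => sg b (f J)) = sg b (wsum k f).
Proof.
elim: k f => [|k IH] f //=.
by rewrite sg_sum; apply: eq_bigr => c _; rewrite IH.
Qed.

(** Each of the [k.+1] positions of the picked letter contributes the same total, because the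
    remaining letters run over all words of length [k]. *)
Lemma wsum_picks k phi :
  wsum k.+1 (picks phi) = (\sum_c wsum k (phi c)) *+ k.+1.
Proof.
elim: k phi => [|k IH] phi; first by apply: eq_bigr => c _ /=; rewrite addr0.
rewrite [LHS]/=.
transitivity (\sum_c (wsum k.+1 (phi c) +
   (\sum_b wsum k (fun M => phi b (c :: M))) *+ k.+1)).
  by apply: eq_bigr => c _; rewrite -IH -wsumD.
by rewrite big_split /= sumrMnl exchange_big -mulrS.
Qed.

(** For the generators and [e = false] this is k! str H_k Z_1 ... Z_k; for the transposed matrix
    over the converse ring and [e = true] it is k! str A_k Z_1 ... Z_k. See [strk_Hsym] and
    [strk_Asym]. *)
Definition imm_trace k : S := wsum k (fun J => sg (wpar J) (superimm J J)).

(* A supertrace over all tensor factors but the first. *)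
Definition imm_ptrace k p q : S :=
  wsum k (fun L => sg (~~ (par p (+) par q) && wpar L) (superimm (p :: L) (q :: L))).

Lemma imm_trace0 : imm_trace 0 = 1.
Proof. by []. Qed.

Lemma imm_traceS k : imm_trace k.+1 = \sum_p sg (par p) (imm_ptrace k p p).
Proof.
rewrite /imm_trace /=; apply: eq_bigr => p _; rewrite -wsum_sg; apply: eq_wsum => L _.
by rewrite addbb /= !sgA.
Qed.

Lemma imm_ptrace0 p q : imm_ptrace 0 p q = w p q.
Proof. by rewrite /imm_ptrace /= !andbF !sg_false mulr1 sg0 addr0. Qed.

(** The prefix [A] holds the letters already passed, which makes the induction work; moving the row
    [c] across [A] brings every summand to the same shape. *)
Lemma expand_diag (w_manin : manin w) p q d A B :
  sg (e && odd (size A))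
    (expand p (d (+) wpar A) (fun K => superimm (A ++ B) (q :: A ++ K)) B) =
  picks (fun c K => sg (par c && d) (w p c * superimm (c :: A ++ K) (q :: A ++ K))) B.
Proof.
elim: B A => [|c B IH] A; first by rewrite /= sg0.
rewrite [LHS]/= [RHS]/= sgD; congr (_ + _).
  rewrite superimm_movel // sgMr !sgA; congr (sg _ _); rewrite /sg_move.
  by case: (par c); case: (d); case: (wpar A); case: (e); case: (odd _).
transitivity (sg (e && odd (size (rcons A c))) (expand p (d (+) wpar (rcons A c))
      (fun K => superimm (rcons A c ++ B) (q :: rcons A c ++ K)) B)).
  rewrite size_rcons -cats1 wpar_cat /= addbF addbA sgA.
  congr (sg _ _); first by case: (e); case: (odd _).
  by apply: eq_expand => K; rewrite -!catA.
by rewrite IH; apply: eq_picks => b K _; rewrite -cats1 -!catA.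
Qed.

(* The Cayley-Hamilton recursion: expand along the row p; by the symmetry in the rows,
   the k+1 terms that do not pick q all have the same sum. *)
Lemma imm_ptraceS (w_manin : manin w) k p q :
  imm_ptrace k.+1 p q =
  w p q * imm_trace k.+1 +
    sg e (\sum_c w p c * imm_ptrace k c q) *+ k.+1.
Proof.
pose phi c K := sg (~~ (par c (+) par q) && wpar K) (w p c * superimm (c :: K) (q :: K)).
transitivity (wsum k.+1 (fun L => w p q * (sg (wpar L) (superimm L L)) +
    sg e (picks phi L))).
  apply: eq_wsum => L _; rewrite [superimm _ _]/= !sgD sgMr !sgA.
  congr (_ + _).
    by congr (sg _ _); case: (par p); case: (par q); case: (wpar L).
  rewrite (addbC _ e) -sgA; congr (sg _ _).
  transitivity (sg (~~ (par p (+) par q) && wpar L (+) par p && wpar L)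
    (picks (fun c K => sg (par c && (wpar L (+) par q))
      (w p c * superimm (c :: K) (q :: K))) L)).
    have := expand_diag w_manin p q (wpar L (+) par q) [::] L.
    rewrite /= andbF sg_false addbF => <-.
    by congr (sg _ _); rewrite addbC.
  rewrite -picks_sg; apply: eq_picks => c K <-; rewrite sgA; congr (sg _ _).
  by case: (par p); case: (par q); case: (par c); case: (wpar K).
rewrite wsumD wsumMl wsum_sg wsum_picks sgMn; congr (_ + sg _ (_ *+ _)).
apply: eq_bigr => c _; rewrite /imm_ptrace -wsumMl; apply: eq_wsum => L _.
by rewrite sgMr.
Qed.

(** Moving the row [c] and the column [c] to the front produces the same sign twice, so each
    occurrence of [p] in [B] adds one copy of the diagonal value. *)
Lemma picks_mem (w_manin : manin w) p A B : e (+) par p ->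
  picks (fun c K => (c == p)%:R * superimm (c :: A ++ K) (c :: A ++ K)) B =
  superimm (A ++ B) (A ++ B) *+ count_mem p B.
Proof.
move=> ep; elim: B A => //= c B IH A; rewrite mulrnDr; congr (_ + _).
  rewrite superimm_movel // superimm_mover sgA addbb sg_false.
  by case: eqP; rewrite ?mul1r ?mul0r.
have := IH (rcons A c); rewrite cat_rcons => <-.
by apply: eq_picks => b K _; rewrite !cat_rcons.
Qed.

Lemma picks_memb (w_manin : manin w) p J : e (+) par p ->
  picks (fun c K => (c == p)%:R * superimm (c :: K) (c :: K)) J =
  if p \in J then superimm J J else 0.
Proof.
move=> ep; rewrite (picks_mem w_manin [::] J ep) -has_pred1 has_count.
(* A letter [p] that occurs twice makes the diagonal value vanish, so only the multiplicities 0 and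
   1 matter. *)
case E: (count_mem p J) => [|[|n]] //=.
have pJ : p \in J by rewrite -has_pred1 has_count E.
case/path.splitPr: pJ E => A B E.
suff -> : superimm (A ++ p :: B) (A ++ p :: B) = 0 by rewrite mul0rn.
rewrite superimm_movel // superimm_dupl ?sg0 // -has_pred1 has_count.
by move: E; rewrite !count_cat /= eqxx addnCA add1n => -[->].
Qed.

End Expansion.

(** Zeroing the row and the column instead of dropping the index keeps the index type and, by
    [manin_del], the relations. *)
Definition del p w i j : S := if (i == p) || (j == p) then 0 else w i j.

Lemma manin_del w p : manin w -> manin (del p w).
Proof.
move=> w_manin q r c x; rewrite /del.
by case: (q == p); case: (r == p); case: (c == p); case: (x == p);
  rewrite /= ?(mulr0, mul0r, sg0, addr0).
Qed.

Lemma eq_expand_in w w' p d f f' J :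
  {in J, w p =1 w' p} -> (forall K, {subset K <= J} -> f K = f' K) ->
  expand w p d f J = expand w' p d f' J.
Proof.
elim: J d f f' => //= c J IH d f f' eqw eqf; rewrite eqw ?mem_head // eqf.
  congr (_ + sg _ _); apply: IH => [b bJ|K KJ]; first by rewrite eqw // inE bJ orbT.
  by apply: eqf => b; rewrite !inE => /orP[->//|/KJ ->]; rewrite orbT.
by move=> b bJ; rewrite inE bJ orbT.
Qed.

Lemma eq_superimm_in w w' L J : {in L & J, w =2 w'} ->
  superimm w L J = superimm w' L J.
Proof.
elim: L J => //= p L IH J eqw; congr (sg _ _); apply: eq_expand_in => [c cJ|K KJ].
  by rewrite eqw ?mem_head.
by apply: IH => a b aL bK; rewrite eqw ?KJ // inE aL orbT.
Qed.

Lemma expand_row0 w p d f J : (forall c, w p c = 0) -> expand w p d f J = 0.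
Proof.
by move=> w0; elim: J d f => //= c J IH d f; rewrite w0 IH mul0r !sg0 addr0.
Qed.

Hypothesis S_tf : forall x : S, x + x = 0 -> x = 0.

Lemma superimm_del w p J : manin w ->
  superimm (del p w) J J = if p \in J then 0 else superimm w J J.
Proof.
move=> w_manin; case: ifP => [/path.splitPr [A B]|pJ].
  rewrite superimm_movel; last exact: manin_del.
  by rewrite /= expand_row0 ?sg0 // => c; rewrite /del eqxx.
apply: eq_superimm_in => a b aJ bJ; rewrite /del.
by case: eqP => [ap|_]; [rewrite -ap aJ in pJ | case: eqP => // bp; rewrite -bp bJ in pJ].
Qed.

(** Words avoiding [p] give the trace of the deleted matrix. Among the others only those with a
    single [p] survive, and each of its [k.+1] possible places gives the same partial trace. *)
Lemma imm_trace_del w p k : manin w -> e (+) par p ->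
  imm_trace (del p w) k.+1 =
  imm_trace w k.+1 - sg (par p) (imm_ptrace w k p p) *+ k.+1.
Proof.
move=> w_manin ep.
have -> : imm_trace w k.+1 = imm_trace (del p w) k.+1 +
    wsum k.+1 (picks (fun c K => (c == p)%:R * 
      (sg (wpar (c :: K)) (superimm w (c :: K) (c :: K))))).
  rewrite /imm_trace -wsumD; apply: eq_wsum => J _; rewrite superimm_del //.
  transitivity (sg (wpar J) (superimm (del p w) J J) + 
     sg (wpar J) (picks (fun c K => (c == p)%:R * superimm w (c :: K) (c :: K)) J)).
    rewrite superimm_del // picks_memb //.
    by case: ifP; rewrite !sg0 ?add0r ?addr0.
  rewrite superimm_del // -picks_sg; congr (_ + _).
  by apply: eq_picks => c K <-; rewrite sgMr.
rewrite wsum_picks (bigD1 p) //= big1 ?addr0 => [|c /negbTE cp]; last first.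
  by rewrite cp wsumMl mul0r.
rewrite eqxx wsumMl mul1r /imm_ptrace -wsum_sg.
set s1 := wsum _ _; set s2 := wsum _ _; suff -> : s1 = s2 by rewrite addrK.
by apply: eq_wsum => L _; rewrite addbb /= !sgA.
Qed.
End SuperImmanant.

(** * Words as functions on positions, and their inversions *)

Section Words.
Variables (I : finType) (par : I -> bool).

Definition word k (J : {ffun 'I_k -> I}) : seq I := map J (enum 'I_k).
Definition fdel k (i : 'I_k.+1) (J : {ffun 'I_k.+1 -> I}) : {ffun 'I_k -> I} :=
  [ffun a => J (lift i a)].
Definition inversions k (s : 'S_k) (J : {ffun 'I_k -> I}) : nat :=
  \sum_(a < k) \sum_(b < k | (a < b)%N && (s b < s a)%N) par (J a) * par (J b).
Definition permute k (s : 'S_k) (J : {ffun 'I_k -> I}) : {ffun 'I_k -> I} :=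
  [ffun a => J ((s^-1)%g a)].

Lemma word_S k (J : {ffun 'I_k.+1 -> I}) : word J = J ord0 :: word (fdel ord0 J).
Proof.
rewrite /word enum_ordSl /= -map_comp; congr (_ :: _).
by apply: eq_map => a; rewrite /= ffunE.
Qed.

Lemma wpar_word k (J : {ffun 'I_k -> I}) :
  wpar par (word J) = \big[addb/false]_a par (J a).
Proof.
elim: k J => [|k IH] J; first by rewrite big_ord0 /word (size0nil (size_enum_ord 0)).
rewrite word_S big_ord_recl /= IH; congr (_ (+) _).
by apply: eq_bigr => a _; rewrite ffunE.
Qed.

Lemma word_nil (J : {ffun 'I_0 -> I}) : word J = [::].
Proof. by rewrite /word (size0nil (size_enum_ord 0)). Qed.

Lemma fdel_lift0 k (i : 'I_k.+1) (J : {ffun 'I_k.+2 -> I}) :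
  word (fdel (lift ord0 i) J) = J ord0 :: word (fdel i (fdel ord0 J)).
Proof.
rewrite word_S ffunE; congr cons; first by congr (J _); apply: val_inj.
congr word; apply/ffunP => a; rewrite !ffunE; congr (J _); apply: val_inj.
by rewrite /= /bump !leq0n !add1n ltnS addnS.
Qed.

Lemma wsum_word (S : pzRingType) k (F : seq I -> S) :
  \sum_(J : {ffun 'I_k -> I}) F (word J) = wsum k F.
Proof.
elim: k F => [|k IH] F /=.
  rewrite (big_pred1 [ffun a : 'I_0 => False_rect I (notF (ltn_ord a))]).
    by rewrite word_nil.
  by move=> J /=; apply/esym/eqP/ffunP => -[].
transitivity (\sum_c \sum_(K : {ffun 'I_k -> I}) F (c :: word K)); last first.
  by apply: eq_bigr => c _; rewrite (IH (fun K => F (c :: K))).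
rewrite pair_big /=.
pose fcons (x : I * {ffun 'I_k -> I}) : {ffun 'I_k.+1 -> I} :=
  [ffun a => if unlift ord0 a is Some b then x.2 b else x.1].
rewrite (reindex fcons) /=.
  apply: eq_bigr => -[c K] _; rewrite word_S ffunE unlift_none; congr (F (_ :: word _)).
  by apply/ffunP => a; rewrite !ffunE liftK.
exists (fun J : {ffun 'I_k.+1 -> I} => (J ord0, fdel ord0 J)) => [[c K]|J] _ /=.
  rewrite ffunE unlift_none; congr pair.
  by apply/ffunP => a; rewrite !ffunE liftK.
by apply/ffunP => a; rewrite ffunE; case: unliftP => [b|] ->; rewrite ?ffunE.
Qed.

Lemma inversions_lift k (i : 'I_k.+1) (s : 'S_k) (J : {ffun 'I_k.+1 -> I}) :
  inversions (lift_perm i ord0 s) J =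
  (par (J i) * (\sum_(b < k.+1 | (b < i)%N) par (J b)) + inversions s (fdel i J))%N.
Proof.
rewrite /inversions (bigD1_ord i) //= big_pred0 ?add0n => [|b]; last first.
  by rewrite lift_perm_id ltn0 andbF.
rewrite [in RHS]big_mkcond (bigD1_ord i) //= ltnn add0n big_distrr -big_split /=.
apply: eq_bigr => a _; rewrite big_mkcond (bigD1_ord i) //= lift_perm_id lift_perm_lift.
rewrite [(0 < _)%N]isT andbT; congr (_ + _)%N.
  by case: ifP; rewrite ?muln0 // mulnC.
rewrite -big_mkcond /=; apply: eq_big => [b|b _]; last by rewrite !ffunE.
by rewrite lift_perm_lift /= !ltnNge !leq_bump2 ?negbK.
Qed.

(** A permutation is determined by the position sent to 0 and by what it does to the rest;
    injectivity suffices because both sides have the same cardinality. *)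
Lemma lift_perm_bij k :
  bijective (fun x : 'I_k.+1 * 'S_k => lift_perm x.1 ord0 x.2).
Proof.
apply: inj_card_bij; last by rewrite card_prod !card_Sn card_ord.
move=> [i s] [j t] /= e.
have ij : i = j.
  by apply: (@perm_inj _ (lift_perm i ord0 s)); rewrite lift_perm_id e lift_perm_id.
rewrite -ij in e *; congr pair; apply/permP => a.
by apply: (@lift_inj _ ord0); rewrite -!(lift_perm_lift i) e.
Qed.

Lemma sum_lift_perm (V : nmodType) k (F : 'S_k.+1 -> V) :
  \sum_s F s = \sum_i \sum_s F (lift_perm i ord0 s).
Proof.
rewrite pair_big (reindex _ (onW_bij _ (lift_perm_bij k))).
by apply: eq_bigr => -[].
Qed.

End Words.

(** * Superimmanants as sums over permutations *)

Section PermutationExpansion.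
Variables (I : finType) (par : I -> bool) (S : pzRingType) (e : bool) (w : I -> I -> S).
Notation sg := (@sg S).

(** The matrix coefficient of Z_1 ... Z_k ([coef_ZZ]). The sign at [a] is that of moving the entry
    past the letters of [J] after position [a]. *)
Definition wordprod k (J K : {ffun 'I_k -> I}) : S :=
  \prod_(a < k) (sg ((par (J a) (+) par (K a)) &&
     \big[addb/false]_(b < k | (a < b)%N) par (J b)) (w (J a) (K a))).

Lemma wordprodS k (J K : {ffun 'I_k.+1 -> I}) :
  wordprod J K =
  sg ((par (J ord0) (+) par (K ord0)) && wpar par (word (fdel ord0 J)))
    (w (J ord0) (K ord0) * wordprod (fdel ord0 J) (fdel ord0 K)).
Proof.
rewrite /wordprod big_ord_recl sgMl; congr (sg (_ && _) (_ * _)).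
  rewrite wpar_word big_mkcond big_ord_recl /=; apply: eq_bigr => a _.
  by rewrite ffunE.
apply: eq_bigr => a _; rewrite !ffunE; congr (sg (_ && _) _).
rewrite big_mkcond big_ord_recl /= -big_mkcond /=.
by apply: eq_big => [b|b _]; rewrite ?ffunE.
Qed.

Lemma expandE p d f k (J : {ffun 'I_k.+1 -> I}) :
  expand par e w p d f (word J) =
  \sum_(i < k.+1)
    sg ((e && odd i) (+)
        (par (J i) && (d (+) \big[addb/false]_(b < k.+1 | (b < i)%N) par (J b))))
      (w p (J i) * f (word (fdel i J))).
Proof.
elim: k d f J => [|k IH] d f J.
  rewrite word_S word_nil /= sg0 addr0 big_ord1 word_nil /= andbF addFb.
  by rewrite big_pred0 ?addbF.
rewrite word_S big_ord_recl /= andbF addFb big_pred0 // addbF; congr (_ + _).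
rewrite IH sg_sum; apply: eq_bigr => i _; rewrite sgA fdel_lift0.
have E : fdel ord0 J i = J (lift ord0 i) by rewrite ffunE.
rewrite E; congr (sg _ _).
rewrite [in RHS]big_mkcond big_ord_recl /= -big_mkcond /=.
have -> : \big[addb/false]_(b < k.+1 | (b < i)%N) par (fdel ord0 J b) =
  \big[addb/false]_(b < k.+1 | (b < i)%N) par (J (lift ord0 b)).
  by apply: eq_bigr => b _; rewrite ffunE.
have -> : \big[addb/false]_(b < k.+1 | (bump 0 b < bump 0 i)%N) par (J (lift ord0 b)) =
  \big[addb/false]_(b < k.+1 | (b < i)%N) par (J (lift ord0 b)) by [].
by rewrite add0n -!addbA; case: (e); case: (odd i); rewrite /= ?negbK.
Qed.

(** Picking position [i] in the row expansion corresponds to the permutations sending [i] to 0, that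
    is to [lift_perm i ord0 s]; [inversions_lift] accounts for the sign of crossing the earlier
    letters. *)
Lemma superimm_perm k (J K : {ffun 'I_k -> I}) :
  \sum_(s : 'S_k) sg ((e && odd_perm s) (+) odd (inversions par s K))
    (wordprod J (permute s K)) = superimm par e w (word J) (word K).
Proof.
elim: k J K => [|k IH] J K.
  rewrite (big_pred1 1%g) => [|s]; last by rewrite [s]permS0 [RHS]eqxx.
  rewrite !word_nil /= odd_perm1 andbF /inversions /wordprod !big_ord0.
  by [].
rewrite sum_lift_perm [in RHS]word_S /= expandE sg_sum; apply: eq_bigr => i _.
rewrite -IH mulr_sumr !sg_sum; apply: eq_bigr => s _; rewrite wordprodS inversions_lift.
have -> : permute (lift_perm i ord0 s) K ord0 = K i.
  by rewrite ffunE lift_permV lift_perm_id.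
have -> : fdel ord0 (permute (lift_perm i ord0 s) K) = permute s (fdel i K).
  by apply/ffunP => a; rewrite !ffunE lift_permV lift_perm_lift.
rewrite odd_lift_perm /= addbF !sgMr !sgA; congr (sg _ _).
rewrite oddD oddM oddb; set x := \big[addb/false]_(b < _ | _) _.
have -> : odd (\sum_(b < k.+1 | (b < i)%N) par (K b)) = x.
  by rewrite /x; elim/big_rec2: _ => // b y z _ <-; rewrite oddD oddb.
by case: (e); case: (odd i); case: (odd_perm s); case: (par (K i)); case: (x);
  case: (odd _); case: (par (J ord0)); case: (wpar _ _).
Qed.

End PermutationExpansion.

(** * Cramer's rule under the quadratic relations *)

Section Cramer.
Variables (I : finType) (par : I -> bool) (S : pzRingType) (e : bool) (w : I -> I -> S).
Hypothesis S_tf : forall x : S, x + x = 0 -> x = 0.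
Hypothesis w_manin : manin par e w.

(** The [a b] are the cofactors along a row. As [J] has no repetition, each letter is picked at one
    place only, so the cofactors can be indexed by letters; they are the same for all rows [q]. *)
Lemma expand_linear d f (J : seq I) : uniq J -> exists a : I -> S,
  (forall q, expand par e w q d f J = \sum_(b <- J) w q b * a b) /\
  (forall c K, J = c :: K -> a c = sg (par c && d) (f K)).
Proof.
elim: J d f => [|c J IH] d f /=; first by exists (fun=> 0); split=> // q; rewrite big_nil.
case/andP=> cJ /(IH (d (+) par c) (fun K => f (c :: K))) [a [aE _]].
exists (fun b => if b == c then sg (par c && d) (f J) else sg e (a b)).
split=> [q|b K [<- <-]]; last by rewrite eqxx.
rewrite big_cons eqxx sgMr aE sg_sum; congr (_ + _).
rewrite !big_seq; apply: eq_bigr => b bJ; rewrite -sgMr.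
by case: eqP bJ cJ => // -> ->.
Qed.

(** Pairing the cofactors with the row [p] gives the full superimmanant up to sign, and pairing them
    with another row of [K] gives 0 by [superimm_dupl]. Multiplying by the left inverse [v] isolates
    the cofactor at [p], which is the superimmanant of [L] up to sign. *)
Lemma superimm_cramer (v : I -> I -> S) p L :
  uniq (p :: L) -> {in p :: L, forall c, e (+) par c} ->
  {in p :: L &, forall i l, \sum_(j <- p :: L) v i j * w j l = (i == l)%:R} ->
  superimm par e w L L = v p p * superimm par e w (p :: L) (p :: L).
Proof.
set K := p :: L => Ku Ke vw.
have [a [aE /(_ p L erefl) ap]] :=
  expand_linear (wpar par L) (superimm par e w L) Ku.
have parK q : q \in K -> par q = ~~ e by move/Ke; case: (par q) (e) => -[].
have rowE q : q \in K -> \sum_(b <- K) w q b * a b =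
    if q == p then sg (par p && wpar par L) (superimm par e w K K) else 0.
  move=> qK; rewrite -aE; case: eqP => [->|/eqP qp]; first by rewrite /= sgA addbb.
  have qL : q \in L by move: qK; rewrite inE (negbTE qp).
  have := superimm_dupl S_tf w_manin K (Ke _ qK) qL.
  by move/(congr1 (sg (par q && wpar par L))); rewrite /= sgA addbb sg0.
have : a p = sg (par p && wpar par L) (v p p * superimm par e w K K).
  transitivity (\sum_(b <- K) (\sum_(j <- K) v p j * w j b) * a b).
    rewrite (bigD1_seq p) //= ?mem_head // vw ?mem_head // eqxx mul1r.
    rewrite big_seq_cond big1 ?addr0 // => b /andP[bK bp].
    by rewrite vw ?mem_head // eq_sym (negbTE bp) mul0r.
  transitivity (\sum_(j <- K) v p j * \sum_(b <- K) w j b * a b).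
    under eq_bigr do rewrite mulr_suml.
    rewrite exchange_big; apply: eq_bigr => j _ /=.
    by rewrite mulr_sumr; apply: eq_bigr => b _; rewrite mulrA.
  rewrite (bigD1_seq p) //= ?mem_head // rowE ?mem_head // eqxx sgMr.
  rewrite big_seq_cond big1 ?addr0 // => b /andP[bK bp].
  by rewrite rowE // (negbTE bp) mulr0.
rewrite ap => /(congr1 (sg (par p && wpar par L))).
by rewrite !sgA addbb.
Qed.

End Cramer.

(** * The action of the tensor superalgebra *)

Section TensorModule.
Variables (F : fieldType) (m n k : nat).
Notation N := (m + n)%N.
Notation M := (rqM F m n).
Notation z := (@rq_gen F m n).
Notation par := (@par m n).
Implicit Types (X Y : stens F m n k) (I J K L : midx m n k).

Lemma sg_scale (b : bool) (x : M) : (-1) ^+ b *: x = sg b x.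
Proof. exact: scaler_sign. Qed.

Lemma sg_scale_nat (d : nat) (x : M) : (-1) ^+ d *: x = sg (odd d) x.
Proof. by rewrite -signr_odd scaler_sign. Qed.

(* The matrix coefficients of the action of X on (C^(m|n))^((x) k) (x) M; as M stands
   on the right, they multiply without further signs (coefM). *)
Definition coef X I J : M :=
  (-1) ^+ koszul (mdeg I J) (fun a => par (J a)) *:
    rq_twist (\sum_a par (J a)) (X (I, J)).

Lemma coefM X Y I L : coef (X * Y) I L = \sum_J coef X I J * coef Y J L.
Proof.
rewrite /coef [(X * Y) _]ffunE linear_sum scaler_sumr; apply: eq_bigr => J _ /=.
rewrite linearZ /= rq_twistM scalerA -scalerAl -scalerAr scalerA -rq_twistD.
congr (_ *: (_ * _)).
  rewrite (mdeg_add I J L) koszul_addl.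
  have -> : (fun a => par (J a)) = (fun a => mdeg J L a (+) par (L a)).
    by apply: funext => a; rewrite /mdeg -addbA addbb addbF.
  rewrite (koszul_addr F (mdeg I J) (mdeg J L) (fun a => par (L a))).
  by rewrite -!mulrA mulrCA [RHS]mulrC -!mulrA [RHS]mulrCA [X in _ * X]mulrC.
rewrite rq_twist_odd [RHS]rq_twist_odd; congr (rq_twist (nat_of_bool _) _).
rewrite addnC -odd_sum_addb; congr odd; apply: eq_bigr => a _.
by rewrite /mdeg -addbA addbb addbF.
Qed.

Lemma coef1 I J : coef 1 I J = (I == J)%:R.
Proof.
rewrite /coef [X in rq_twist _ X]stens_oneE.
case: eqP => [<-|_]; last by rewrite linear0 scaler0.
rewrite rq_twist1 /koszul big1 ?scale1r // => a _.
by rewrite big1 // => b _; rewrite mdegxx.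
Qed.

(** The second sign in [Pperm] equals the Koszul sign in [coef], so the two cancel. *)
Lemma coef_perm s I J :
  coef (Pperm F m n s) I J =
  if I == perm_midx s J then sg (odd (inversions par s J)) 1 else 0.
Proof.
rewrite /coef [Pperm _ _ _ _ _]ffunE /=; case: eqP => _; last by rewrite linear0 scaler0.
rewrite linearZ /= rq_twist1 scalerA exprD mulrCA -sg_scale_nat -exprD addnn.
by rewrite -[X in _ * X]signr_odd odd_double mulr1.
Qed.

Definition agree_off (s : seq 'I_k) I J := [forall b, (b \notin s) ==> (I b == J b)].

Lemma Zpos_coef a I J : Zpos F m n a (I, J) =
  if agree_off [:: a] I J then
    (-1) ^+ (par (I a) * par (J a) + par (J a)) *: z (I a) (J a) else 0.
Proof.
have prodE (i j : 'I_N) :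
  (\prod_b (if b == a then delta_mx i j else 1%:M : 'M[F]_N) (I b) (J b)) =
  ((I a == i) && (J a == j))%:R * (agree_off [:: a] I J)%:R.
  rewrite (bigD1 a) //= eqxx mxE; congr (_ * _).
  rewrite /agree_off; case: forallP => [H|H].
    by rewrite big1 // => b ba; rewrite (negbTE ba) mxE (implyP (H b)) // inE.
  have [b] : exists b, ~~ ((b \notin [:: a]) ==> (I b == J b)).
    apply/existsP; apply: contra_notT H; rewrite negb_exists => /forallP H b.
    by have := H b; rewrite negbK.
  rewrite negb_imply inE => /andP[ba neq].
  by rewrite (bigD1 b) //= (negbTE ba) mxE (negbTE neq) mul0r.
rewrite /Zpos sum_ffunE (bigD1 (I a)) //= [X in _ + X]big1 ?addr0 => [|i iI]; last first.
  rewrite sum_ffunE big1 // => j _.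
  by rewrite ffunE /= prodE eq_sym (negbTE iI) mul0r scale0r.
rewrite sum_ffunE (bigD1 (J a)) //= [X in _ + X]big1 ?addr0 => [|j jJ]; last first.
  by rewrite ffunE /= prodE (eq_sym (J a)) (negbTE jJ) andbF mul0r scale0r.
rewrite ffunE /= prodE !eqxx mul1r.
by case: ifP => _; rewrite ?scale1r ?scale0r.
Qed.

Lemma rq_gen_homog i j : rq_homog (par i (+) par j) (z i j).
Proof. exact: rq_parity_gen. Qed.

Lemma agree_offP (s : seq 'I_k) I J :
  reflect (forall b, b \notin s -> I b = J b) (agree_off s I J).
Proof.
apply: (iffP forallP) => H b; first by move=> bs; apply/eqP; apply: (implyP (H b)).
by apply/implyP => bs; apply/eqP/H.
Qed.

Lemma odd_sum_bool (P : pred 'I_k) (f : 'I_k -> bool) :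
  odd (\sum_(b | P b) f b) = \big[addb/false]_(b | P b) f b.
Proof. by elim/big_rec2: _ => // b x y _ <-; rewrite oddD oddb. Qed.

Lemma coef_Zpos a I J :
  coef (Zpos F m n a) I J =
  if agree_off [:: a] I J then
    sg ((par (I a) (+) par (J a)) && \big[addb/false]_(b < k | (a < b)%N) par (J b))
      (z (I a) (J a))
  else 0.
Proof.
rewrite /coef Zpos_coef; case: agree_offP => [IJ|_]; last by rewrite linear0 scaler0.
rewrite linearZ /= (rq_twist_homog _ (rq_gen_homog _ _)) !scalerA -!exprD sg_scale_nat.
(* The words agree off [a], so only position [a] can have odd degree. *)
have -> : koszul (mdeg I J) (fun b => par (J b)) =
    (\sum_(b < k | (b < a)%N) mdeg I J a * par (J b))%N.
  rewrite /koszul (bigD1 a) //= [X in (_ + X)%N]big1 ?addn0 // => c ca.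
  by rewrite big1 // => b _; rewrite /mdeg IJ ?addbb // inE.
congr (sg _ _).
rewrite -big_distrr /= !(oddD, oddM) !odd_sum_bool !oddb.
have -> : \big[addb/false]_b par (J b) =
    par (J a) (+) (\big[addb/false]_(b < k | (b < a)%N) par (J b) (+)
    \big[addb/false]_(b < k | (a < b)%N) par (J b)).
  rewrite (bigD1 a) //=; congr (_ (+) _).
  rewrite (bigID (fun b : 'I_k => (b < a)%N)) /=; congr (_ (+) _); apply: eq_bigl => b;
   by rewrite -val_eqE /=; case: ltngtP.
rewrite /mdeg; case: (par (I a)); case: (par (J a)); by do 2!case: (\big[_/_]_(_ | _) _).
Qed.

Lemma coef_prod_Zpos (s : seq 'I_k) I J : sorted (fun a b : 'I_k => (a < b)%N) s ->
  coef (\prod_(a <- s) Zpos F m n a) I J =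
  if agree_off s I J then
    \prod_(a <- s) sg ((par (I a) (+) par (J a)) &&
      \big[addb/false]_(b < k | (a < b)%N) par (I b)) (z (I a) (J a))
  else 0.
Proof.
elim: s I => [|a s IH] I srt.
  rewrite !big_nil coef1; case: agree_offP => [IJ|nIJ].
    by have -> : I = J by [apply/ffunP => b; apply: IJ]; rewrite eqxx.
  by case: eqP => // IJ; case: nIJ => b _; rewrite IJ.
have /= lt_s : path (fun a b : 'I_k => (a < b)%N) a s by [].
have a_lt b : b \in s -> (a < b)%N.
  have tr : transitive (fun a b : 'I_k => (a < b)%N) by move=> ? ? ?; apply: ltn_trans.
  by move: lt_s; rewrite (path_sortedE tr) => /andP[/allP H _] /H.
have as_ : a \notin s by apply/negP => /a_lt; rewrite ltnn.
rewrite !big_cons coefM.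
(* The only intermediate word that contributes: the first factor changes at most the letter at [a],
   and the later factors leave that letter alone. *)
pose K0 : midx m n k := [ffun b => if b == a then J a else I b].
rewrite (bigD1 K0) //= [X in _ + X]big1 ?addr0 => [|K neK]; last first.
  rewrite coef_Zpos IH ?(path_sorted lt_s) //.
  case: agree_offP => [IK|]; last by rewrite mul0r.
  case: agree_offP => [KJ|]; last by rewrite mulr0.
  case/eqP: neK; apply/ffunP => b; rewrite ffunE.
  by case: eqP => [->|/eqP ba]; [rewrite KJ | rewrite IK // inE].
rewrite coef_Zpos IH ?(path_sorted lt_s) // ffunE eqxx.
have -> : agree_off [:: a] I K0.
  by apply/agree_offP => b; rewrite inE ffunE => /negbTE ->.
have -> : agree_off s K0 J = agree_off (a :: s) I J.
  apply/agree_offP/agree_offP => H b.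
    by rewrite inE negb_or => /andP[ba bs]; rewrite -H // ffunE (negbTE ba).
  by move=> bs; rewrite ffunE; case: eqP => [->//|/eqP ba]; rewrite H // inE negb_or ba.
case: ifP => _; last by rewrite mulr0.
congr (sg (_ && _) _ * _).
  by apply: eq_bigr => b ab; rewrite ffunE; case: eqP ab => // ->; rewrite ltnn.
rewrite !big_seq; apply: eq_bigr => c cs; rewrite !ffunE.
have -> : (c == a) = false by apply/eqP => ca; rewrite ca (negbTE as_) in cs.
congr (sg (_ && _) _); apply: eq_bigr => b cb; rewrite ffunE.
by case: eqP cb => // ->; rewrite ltnNge (ltnW (a_lt _ cs)).
Qed.

Lemma coef_ZZ I J :
  coef (\prod_(a < k) Zpos F m n a) I J = wordprod par z I J.
Proof.
have E (R : pzSemiRingType) (f : 'I_k -> R) :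
    \prod_(a < k) f a = \prod_(a <- enum 'I_k) f a.
  by rewrite [index_enum _]unlock -enumT.
rewrite E coef_prod_Zpos; last first.
  by have := iota_ltn_sorted 0 k; rewrite -val_enum_ord sorted_map.
have -> : agree_off (enum 'I_k) I J.
  by apply/agree_offP => b; rewrite mem_enum.
by rewrite -E.
Qed.

Lemma rq_parity_wordprod I J : 
  rq_parity (wordprod par z I J) =
  sg (wpar par (word I) (+) wpar par (word J)) (wordprod par z I J).
Proof.
rewrite !wpar_word -big_split /=.
suff E (t : 'I_k -> bool) r : rq_parity (\prod_(a <- r) sg (t a) (z (I a) (J a))) =
    sg (\big[addb/false]_(a <- r) (par (I a) (+) par (J a)))
      (\prod_(a <- r) sg (t a) (z (I a) (J a))) by exact: E.
elim: r => [|a r IH]; first by rewrite !big_nil rmorph1.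
rewrite !big_cons rmorphM /= IH -[in LHS]sg_scale linearZ /= rq_parity_gen !sg_scale.
rewrite !(sgMl, sgMr) !sgA; congr (sg _ _); set b := \big[addb/false]_(_ <- _) _.
by case: (t a); case: (par (I a)); case: (par (J a)); case: (b).
Qed.

Lemma wpar_permute (s : 'S_k) J : wpar par (word (perm_midx s J)) = wpar par (word J).
Proof.
rewrite !wpar_word (reindex_inj (@perm_inj _ s)); apply: eq_bigr => a _.
by rewrite ffunE permK.
Qed.

Lemma strk_perm (s : 'S_k) :
  strk (Pperm F m n s * \prod_(a < k) Zpos F m n a) =
  \sum_(J : midx m n k) sg (wpar par (word J) (+) odd (inversions par s J))
     (wordprod par z J (perm_midx s J)).
Proof.
(* On the diagonal the Koszul sign is trivial, and applying the twist a second time undoes it. *)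
have diag X I : X (I, I) = rq_twist (\sum_a par (I a)) (coef X I I).
  have -> : X (I, I) = rq_twist (\sum_a par (I a) + \sum_a par (I a)) (X (I, I)).
    by rewrite rq_twist_odd addnn odd_double.
  rewrite rq_twistD /coef [koszul _ _]big1 ?scale1r // => a _.
  by rewrite big1 // => b _; rewrite mdegxx.
rewrite /strk.
transitivity (\sum_I \sum_(J | I == perm_midx s J)
  sg (wpar par (word J) (+) odd (inversions par s J)) (wordprod par z J (perm_midx s J))).
  apply: eq_bigr => I _; rewrite diag coefM linear_sum scaler_sumr [RHS]big_mkcond.
  apply: eq_bigr => J _; rewrite coef_perm coef_ZZ.
  case: eqP => [->|_]; last by rewrite mul0r linear0 scaler0.
  rewrite sgMl mul1r -sg_scale linearZ /= sg_scale_nat sg_scale.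
  rewrite rq_twist_odd odd_sum_bool -wpar_word wpar_permute.
  (* A word and its permutation have equal parity, so the product is even and the twist fixes it. *)
  have -> b : rq_twist (nat_of_bool b) (wordprod par z J (perm_midx s J)) =
      wordprod par z J (perm_midx s J).
    by case: b => //=; rewrite rq_parity_wordprod wpar_permute addbb.
  by rewrite sgA.
rewrite (exchange_big_dep predT) //=; apply: eq_bigr => J _.
by rewrite big_pred1_eq.
Qed.

Lemma stens_scaleMl c X Y : (c *: X) * Y = c *: (X * Y).
Proof.
apply/ffunP => -[I L]; rewrite !ffunE scaler_sumr; apply: eq_bigr => J _.
by rewrite ffunE linearZ /= -scalerAl !scalerA mulrC.
Qed.

Lemma strkZ c X : strk (c *: X) = c *: strk X.
Proof.
rewrite /strk scaler_sumr; apply: eq_bigr => I _.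
by rewrite ffunE !scalerA mulrC.
Qed.

Lemma strk_sum (T : finType) (G : T -> stens F m n k) :
  strk (\sum_t G t) = \sum_t strk (G t).
Proof.
rewrite /strk exchange_big; apply: eq_bigr => I _ /=.
by rewrite sum_ffunE scaler_sumr.
Qed.

Lemma strk_Hsym :
  strk (Hsym F m n k * \prod_(a < k) Zpos F m n a) =
  k`!%:R^-1 *: imm_trace par false z k.
Proof.
rewrite stens_scaleMl strkZ mulr_suml strk_sum; congr (_ *: _).
under eq_bigr do rewrite strk_perm.
rewrite exchange_big /= /imm_trace -wsum_word; apply: eq_bigr => J _.
rewrite -superimm_perm sg_sum; apply: eq_bigr => s _.
by rewrite sgA.
Qed.

End TensorModule.

(** * Passage to the converse ring *)

Lemma prod_converse (S : pzRingType) k (f : 'I_k -> S) :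
  \prod_(a < k) f a = \prod_(a < k) (f (rev_ord a) : S^c) :> S.
Proof.
elim: k f => [|k IH] f; first by rewrite !big_ord0.
rewrite big_ord_recl big_ord_recr /= IH.
have -> : rev_ord ord_max = ord0 :> 'I_k.+1 by apply: val_inj; rewrite /= subnn.
congr (_ * _); apply: eq_bigr => a _; congr f; apply: val_inj.
by rewrite /= /bump leq0n add1n subSS -subSn // ltn_ord.
Qed.

Section Reversal.
Variables (m n k : nat).
Notation N := (m + n)%N.
Notation par := (@par m n).
Notation rev := (perm (@rev_ord_inj k)).
Implicit Types (J K : midx m n k) (s : 'S_k).

Lemma permuteM s t J : permute (s * t) J = permute t (permute s J).
Proof. exact: perm_midxM. Qed.

Definition pairs (J : midx m n k) : nat :=
  \sum_(a < k) \sum_(b < k | (b < a)%N) par (J a) * par (J b).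

(** With t odd letters, 2 [pairs] + t = t^2, and t is invariant under permutation. *)
Lemma pairs_permute s J : pairs (permute s J) = pairs J.
Proof.
pose t K := (\sum_a par (K a))%N.
have H K : (2 * pairs K + t K = t K * t K)%N.
  rewrite /t [RHS]big_distrlr /= mul2n -addnn /pairs.
  have E : (\sum_(a < k) \sum_(b < k | (b < a)%N) par (K a) * par (K b) =
            \sum_(a < k) \sum_(b < k | (a < b)%N) par (K a) * par (K b))%N.
    rewrite (exchange_big_dep predT) //=; apply: eq_bigr => a _.
    by apply: eq_bigr => b _; rewrite mulnC.
  rewrite {1}E -!big_split; apply: eq_bigr => a _ /=.
  rewrite [RHS](bigD1 a) //= [RHS]addnC; congr (_ + _)%N; last by case: (par _).
  rewrite [RHS](bigID (fun b : 'I_k => (a < b)%N)) /=.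
  by congr (_ + _)%N; apply: eq_bigl => b; rewrite -val_eqE /=; case: ltngtP.
have tE : t (permute s J) = t J.
  rewrite /t (reindex_inj (@perm_inj _ s)); apply: eq_bigr => a _.
  by rewrite ffunE permK.
have /eqP := H (permute s J).
by rewrite tE -H eqn_add2r eqn_pmul2l // => /eqP.
Qed.

Lemma inversions_rev J : inversions par rev J = pairs J.
Proof.
rewrite /inversions /pairs (exchange_big_dep predT) //=; apply: eq_bigr => a _.
apply: eq_big => [b|b _]; last by rewrite mulnC.
rewrite !permE /=; case: (ltnP b a) => //= ba.
by rewrite ltn_sub2l // (leq_trans _ (ltn_ord a)) // ltnS.
Qed.

(** Expand the inversions of [rev] and of [s * rev] by the cocycle rule. Each full reversal
    contributes [pairs J], and the two contributions cancel. *)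
Lemma odd_inversions_rev s J :
  odd (inversions par ((s * rev)^-1 * rev) (permute (s * rev) J)) = odd (inversions par s J).
Proof.
have C u t K : odd (inversions par (t * u) K) =
   odd (inversions par u (permute t K)) (+) odd (inversions par t K).
  by rewrite -oddD; exact: perm_inv_cocycle.
have := C ((s * rev)^-1 * rev)%g (s * rev)%g J.
rewrite mulKVg (C rev) !inversions_rev pairs_permute addbA.
by case: (odd _); case: (odd _); case: (odd _).
Qed.

End Reversal.

Section Converse.
Variables (m n : nat) (S : pzRingType) (w : 'I_(m + n) -> 'I_(m + n) -> S).
Notation par := (@par m n).
Notation w' := (fun i j => w j i : S^c).

Lemma prod_sg (R : pzRingType) k (t : 'I_k -> bool) (f : 'I_k -> R) :
  \prod_(a < k) sg (t a) (f a) = sg (\big[addb/false]_(a < k) t a) (\prod_(a < k) f a).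
Proof.
elim: (index_enum _) => [|a r IH]; first by rewrite !big_nil.
by rewrite !big_cons IH sgMl sgMr sgA.
Qed.

(** Reading the product backwards turns the letters to the right of a position into those to its
    left. The mixed parts of the two signs agree after exchanging the sums; the remaining parts are
    the [pairs] of the two words, equal by [pairs_permute]. *)
Lemma wordprod_converse k (s : 'S_k) (J : midx m n k) :
  let rev := perm (@rev_ord_inj k) in
  wordprod par w (permute (s * rev) J) (permute rev J) =
  wordprod par w' J (permute s J) :> S.
Proof.
move=> rev; set K := permute s J.
have KE a : permute (s * rev) J (rev_ord a) = K a.
  rewrite permuteM -/K ffunE; congr (K _); apply: (@perm_inj _ rev).
  by rewrite permKV permE.
have JE a : permute rev J (rev_ord a) = J a.
  by rewrite ffunE; congr (J _); apply: (@perm_inj _ rev); rewrite permKV permE.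
rewrite /wordprod prod_converse.
transitivity (\prod_(a < k) sg ((par (K a) (+) par (J a)) &&
   \big[addb/false]_(b < k | (b < a)%N) par (K b)) (w (K a) (J a) : S^c)).
  apply: eq_bigr => a _; rewrite KE JE; congr (sg (_ && _) _).
  rewrite (reindex_inj rev_ord_inj); apply: eq_big => [b|b _]; last by rewrite KE.
  rewrite /=; case: (ltnP b a) => ba.
    by rewrite ltn_sub2l // (leq_trans _ (ltn_ord a)) // ltnS.
  by rewrite ltnNge leq_sub2l.
rewrite !prod_sg; congr (sg _ _).
have E (f g : 'I_k -> bool) (P : rel 'I_k) :
    \big[addb/false]_(a < k) (f a && \big[addb/false]_(b < k | P b a) g b) =
    odd (\sum_(a < k) \sum_(b < k | P b a) f a * g b).
  rewrite (big_morph odd oddD (erefl _)); apply: eq_bigr => a _.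
  by rewrite -big_distrr /= oddM oddb odd_sum_bool.
have X (f g : 'I_k -> bool) :
    (\sum_(a < k) \sum_(b < k | (b < a)%N) f a * g b =
     \sum_(a < k) \sum_(b < k | (a < b)%N) g a * f b)%N.
  rewrite (exchange_big_dep predT) //=; apply: eq_bigr => a _.
  by apply: eq_bigr => b _; rewrite mulnC.
under eq_bigr do rewrite andb_addl.
under [in RHS]eq_bigr do rewrite andb_addl addbC.
rewrite !big_split /= [LHS]addbC [RHS]addbC [RHS]addbC.
rewrite !(E _ _ (fun b a => (b < a)%N)) !(E _ _ (fun b a => (a < b)%N)).
rewrite -(X (fun a => par (J a)) (fun a => par (K a))).
rewrite -(X (fun a => par (J a)) (fun a => par (J a))).
by congr (_ (+) odd _); rewrite -/(pairs K) pairs_permute.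
Qed.

Lemma imm_trace_converse k :
  \sum_(s : 'S_k) sg (odd_perm s) (\sum_(J : midx m n k)
    sg (wpar par (word J) (+) odd (inversions par s J)) (wordprod par w J (permute s J))) =
  imm_trace par true w' k :> S.
Proof.
pose rev := perm (@rev_ord_inj k).
transitivity (\sum_(s : 'S_k) sg (odd_perm s) (\sum_(J : midx m n k)
    sg (wpar par (word J) (+) odd (inversions par s J))
       (wordprod par w' J (permute s J) : S))).
  (* Transposition inverts the permutation and reversing the factors conjugates it by [rev]; the
     sign of the permutation is unchanged. *)
  rewrite (reindex_inj (h := fun s => ((s * rev)^-1 * rev)%g)) => [|s t /mulIg/invg_inj/mulIg//].
  apply: eq_bigr => s _; rewrite odd_permM odd_permV odd_permM -addbA addbb addbF.
  congr (sg _ _).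
  have inj : injective (permute (s * rev)%g : midx m n k -> midx m n k).
    move=> J K /(congr1 (permute (s * rev)^-1%g)).
    rewrite -!permuteM mulgV => e; apply/ffunP => a; move/ffunP/(_ a): e.
    by rewrite !ffunE invg1 perm1.
  rewrite (reindex_inj inj); apply: eq_bigr => J _.
  rewrite odd_inversions_rev -permuteM mulKVg wordprod_converse.
  by rewrite -[permute (s * rev) J]/(perm_midx _ J) wpar_permute.
rewrite /imm_trace -wsum_word.
rewrite (eq_bigr _ (fun s _ => sg_sum _ _ _ _)) exchange_big; apply: eq_bigr => J _.
rewrite -superimm_perm sg_sum; apply: eq_bigr => s _ /=.
by rewrite !sgA addbCA addbA.
Qed.

End Converse.

Lemma strk_Asym (F : fieldType) (m n k : nat) :
  strk (Asym F m n k * \prod_(a < k) Zpos F m n a) =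
  k`!%:R^-1 *:
    (imm_trace (@par m n) true (fun i j => rq_gen F j i : (rqM F m n)^c) k : rqM F m n).
Proof.
rewrite stens_scaleMl strkZ mulr_suml strk_sum; congr (_ *: _).
rewrite -imm_trace_converse; apply: eq_bigr => s _.
by rewrite stens_scaleMl strkZ strk_perm sg_scale.
Qed.

(** * Newton and Cayley-Hamilton identities *)

Section RightQuantumManin.
Variables (m n : nat) (S : pzRingType) (z : 'I_(m + n) -> 'I_(m + n) -> S).
Hypothesis z_rq : right_quantum z.

Lemma mulr_sgn (d : nat) (x : S) : (-1) ^+ d * x = sg (odd d) x.
Proof. by rewrite -signr_odd mulr_sign. Qed.

Lemma sgN b (x : S) : - sg b x = sg (~~ b) x.
Proof. by case: b; rewrite /sg ?opprK. Qed.

Lemma addr_cross (a b c d : S) : a + b = c + d -> a - d = c - b.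
Proof. by move=> E; apply/eqP; rewrite subr_eq addrAC -E addrK. Qed.

Lemma manin_right_quantum : manin (@par m n) false z.
Proof.
move=> p r c x; have := z_rq p c r x; rewrite /scomm !mulr_sgn !(oddD, oddM, oddb) !sgN.
move/(congr1 (sg (par c && par r))); rewrite !sgD !sgA => /addr_cross; rewrite !sgN => E.
transitivity (sg (par c && par r) (z p c * z r x) +
  sg (par x && (par r (+) par c)) (z p x * z r c)); first by [].
etransitivity; last (etransitivity; [exact: E|]).
  congr (_ + sg _ _).
  by case: (par p); case: (par r); case: (par c); case: (par x).
congr (sg _ _ + sg _ _);
  by case: (par p); case: (par r); case: (par c); case: (par x).
Qed.

Lemma manin_converse : manin (@par m n) true (fun i j => z j i : S^c).
Proof.
move=> p r c x; have := z_rq x r c p; rewrite /scomm !mulr_sgn !(oddD, oddM, oddb) !sgN.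
move/(congr1 (sg (par c && par r))); rewrite !sgD !sgA [RHS]addrC.
move/addr_cross; rewrite !sgN => E.
suff : sg (par c && par r) (z x r * z c p) +
    sg (true (+) (par x && (par r (+) par c))) (z c r * z x p) =
  sg (true (+) (par p && par r) (+) (par c && par p)) (z x p * z c r) +
    sg ((par p && par r) (+) (par x && (par p (+) par c))) (z c p * z x r) by [].
etransitivity; last (etransitivity; [exact: E|]).
  congr (_ + sg _ _).
  by case: (par p); case: (par r); case: (par c); case: (par x).
congr (sg _ _ + sg _ _);
  by case: (par p); case: (par r); case: (par c); case: (par x).
Qed.

End RightQuantumManin.

(** * Power series in u, the matrix Z(u) and its inverse *)

Section PowerSeries.
Variable S : pzRingType.
Implicit Types (f g : fps S) (a : S).

Lemma fpsP f g : (forall k, f k = g k) -> f = g.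
Proof. by move=> E; apply: funext. Qed.

Lemma fps_coefCM a f k : (fpsC a * f) k = a * f k.
Proof. by rewrite fps_coefM big_ord_recl big1 ?addr0 ?subn0 // => i _; rewrite mul0r. Qed.

Lemma fps_coefMC a f k : (f * fpsC a) k = f k * a.
Proof.
rewrite fps_coefM big_ord_recr /= subnn big1 ?add0r // => i _.
by have := ltn_ord i; rewrite -subn_gt0; case: (k - i)%N => //= j _; rewrite mulr0.
Qed.

Lemma fps_coefXM f k : (fpsX * f) k = if k is k'.+1 then f k' else 0.
Proof.
rewrite fps_coefM /fpsX; case: k => [|k]; first by rewrite big_ord1 mul0r.
rewrite big_ord_recl mul0r add0r big_ord_recl /= mul1r subn1 big1 ?addr0 // => i _.
by rewrite mul0r.
Qed.

Lemma fpsXC f : f * fpsX = fpsX * f.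
Proof.
apply: fpsP => k; rewrite fps_coefXM fps_coefM /fpsX; case: k => [|k].
  by rewrite big_ord1 mulr0.
rewrite big_ord_recr /= subnn mulr0 addr0 big_ord_recr /= subSnn mulr1 big1 ?add0r // => i _.
have : (1 < k.+1 - i)%N by rewrite ltn_subRL addn1 ltnS.
by case: (k.+1 - i)%N => [|[|j]] // _; rewrite mulr0.
Qed.

Lemma fps_derivM f g : fps_deriv (f * g) = fps_deriv f * g + f * fps_deriv g.
Proof.
apply: fpsP => k; rewrite fps_coefD /fps_deriv !fps_coefM -sumrMnl.
transitivity (\sum_(i < k.+2) (f i *+ i * g (k.+1 - i)%N + f i * (g (k.+1 - i)%N *+ (k.+1 - i)))).
  apply: eq_bigr => i _; rewrite mulrnAl mulrnAr -mulrnDr subnKC //.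
  by rewrite -ltnS ltn_ord.
rewrite big_split /= big_ord_recl mulr0n mul0r add0r; congr (_ + _).
rewrite big_ord_recr /= subnn mulr0n mulr0 addr0.
by apply: eq_bigr => i _; rewrite subSn // -ltnS ltn_ord.
Qed.

Lemma fps_inv_unique f g : f 0%N = 1 -> f * g = 1 -> fps_inv f = g.
Proof. by move=> f0 fg; rewrite -[LHS]mulr1 -fg mulrA fps_mulVf // mul1r. Qed.

End PowerSeries.

Section MatrixSeries.
Variables (S : pzRingType) (N : nat).
Implicit Types (A B : fps 'M[S]_N) (Z : 'M[S]_N).

Definition mxfps A : 'M[fps S]_N := \matrix_(i, j) fps_entry A i j.

Lemma mxfpsM A B : mxfps (A * B) = mxfps A *m mxfps B.
Proof.
apply/matrixP => i j; rewrite !mxE; apply: fpsP => k.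
rewrite fps_coef_sum /fps_entry fps_coefM summxE.
under [RHS]eq_bigr do rewrite !mxE fps_coefM.
rewrite exchange_big; apply: eq_bigr => l _ /=.
by rewrite mxE.
Qed.

Lemma mxfps1 : mxfps 1 = 1%:M.
Proof.
apply/matrixP => i j; rewrite !mxE; apply: fpsP => -[|k]; rewrite /fps_entry mxE.
  by case: (i == j).
by case: (i == j).
Qed.

Definition char_mx Z : fps 'M[S]_N := 1 + fpsX * fpsC Z.
Definition geom_mx Z : fps 'M[S]_N := fun k => (- Z) ^+ k.

Lemma char_mx0 Z : char_mx Z 0%N = 1.
Proof. by rewrite /char_mx fps_coefD fps_coefXM addr0. Qed.

Lemma char_geom Z : char_mx Z * geom_mx Z = 1.
Proof.
apply: fpsP => k; rewrite /char_mx mulrDl mul1r -mulrA fps_coefD fps_coefXM.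
case: k => [|k]; first by rewrite addr0 /geom_mx expr0.
by rewrite fps_coefCM /geom_mx exprS mulNr addNr.
Qed.

Lemma fps_inv_char Z : fps_inv (char_mx Z) = geom_mx Z.
Proof. exact: fps_inv_unique (char_mx0 Z) (char_geom Z). Qed.

Lemma geom_char Z : geom_mx Z * char_mx Z = 1.
Proof. by rewrite -fps_inv_char fps_mulVf // char_mx0. Qed.

Lemma geomC Z : geom_mx Z * fpsC Z = fpsC Z * geom_mx Z.
Proof.
apply: fpsP => k; rewrite fps_coefCM fps_coefMC /geom_mx.
by apply: oppr_inj; rewrite -mulrN -mulNr -exprS -exprSr.
Qed.

Lemma char_mxE Z i j :
  mxfps (char_mx Z) i j = (i == j)%:R + fpsX * fpsC (Z i j).
Proof.
rewrite mxE; apply: fpsP => k; rewrite /fps_entry /char_mx fps_coefD mxE.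
rewrite fps_coefD !fps_coefXM; congr (_ + _).
  rewrite -[(1 : fps _) k]/(if k is 0 then _ else _).
  by case: k => [|k]; rewrite mxE; case: (i == j).
by case: k => [|[|k]]; rewrite ?mxE.
Qed.

End MatrixSeries.

Section NewtonCayleyHamilton.
Variables (F : fieldType) (S : algType F) (m n : nat).
Hypothesis F0 : [pchar F] =i pred0.
Notation N := (m + n)%N.
Notation par := (@par m n).
Implicit Types (Z : 'M[S]_N).

Lemma natr_neq0 k : k.+1%:R != 0 :> F.
Proof. by rewrite ((pcharf0P F).1 F0). Qed.

Lemma factS_invr k : k.+1`!%:R^-1 * k.+1%:R = k`!%:R^-1 :> F.
Proof. by rewrite factS natrM invfM mulrAC mulVf ?mul1r ?natr_neq0. Qed.

Lemma fact_mulrn k (x : S) : k.+1`!%:R^-1 *: (x *+ k.+1) = k`!%:R^-1 *: x.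
Proof. by rewrite -scaler_nat scalerA factS_invr. Qed.

Lemma algebra_tf (x : S) : x + x = 0 -> x = 0.
Proof.
move=> /(congr1 (fun y => 2%:R^-1 *: y)).
by rewrite -mulr2n -scaler_nat scalerA mulVf ?natr_neq0 // scale1r scaler0.
Qed.

Definition right_quantum_mx (R : pzRingType) (Z : 'M[R]_N) := right_quantum (fun i j => Z i j).

(** [sym_series] is H(u) and [alt_series] is E(u); transposing over the converse ring lets the case
    [e = true] of [superimm] serve for E(u). *)
Definition sym_series Z : fps S :=
  fun k => k`!%:R^-1 *: imm_trace par false (fun i j => Z i j) k.
Definition alt_series Z : fps S :=
  fun k => k`!%:R^-1 *: (imm_trace par true (fun i j => Z j i : S^c) k : S).

(** The generating series of supertraces over all tensor factors but one. The coefficient of u^k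
    involves k + 1 factors, a shift by one against [sym_series]. *)
Definition sym_mx Z : 'M[fps S]_N := \matrix_(i, j)
  ((fun k => k`!%:R^-1 *: imm_ptrace par false (fun i j => Z i j) k i j) : fps S).
Definition alt_mx Z : 'M[fps S]_N := \matrix_(i, j)
  ((fun k => k`!%:R^-1 *: (imm_ptrace par true (fun i j => Z j i : S^c) k j i : S)) : fps S).

Definition constm Z : 'M[fps S]_N := map_mx (@fpsC S) Z.

Definition del_mx (R : pzRingType) p (Z : 'M[R]_N) : 'M[R]_N :=
  \matrix_(i, j) del p (fun i j => Z i j) i j.

Lemma sum_fpsC_coef (T : finType) (a : T -> S) (f : T -> fps S) k :
  (\sum_t fpsC (a t) * f t) k = \sum_t a t * f t k.
Proof. by rewrite fps_coef_sum; apply: eq_bigr => t _; rewrite fps_coefCM. Qed.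

Lemma sym_mx_rec Z : right_quantum_mx Z ->
  sym_mx Z = constm Z *m (sym_series Z)%:M + fpsX *: (constm Z *m sym_mx Z).
Proof.
move=> /manin_right_quantum Zq; apply/matrixP => i j; rewrite !mxE.
rewrite (bigD1 j) //= !mxE eqxx mulr1n big1 ?addr0 => [|c cj]; last first.
  by rewrite !mxE (negbTE cj) mulr0n mulr0.
under eq_bigr do rewrite !mxE.
apply: fpsP => k; rewrite fps_coefD fps_coefCM fps_coefXM.
case: k => [|k].
  by rewrite addr0 /sym_series imm_trace0 imm_ptrace0 fact0 invr1 !scale1r mulr1.
rewrite sum_fpsC_coef imm_ptraceS // scalerDr fact_mulrn -scalerAr.
by congr (_ + _); rewrite scaler_sumr; apply: eq_bigr => c _; rewrite -scalerAr.
Qed.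

Lemma alt_mx_rec Z : right_quantum_mx Z ->
  alt_mx Z = (alt_series Z)%:M *m constm Z - fpsX *: (alt_mx Z *m constm Z).
Proof.
move=> /manin_converse Zq; apply/matrixP => i j; rewrite !mxE.
rewrite (bigD1 i) //= !mxE eqxx mulr1n big1 ?addr0 => [|c cj]; last first.
  by rewrite !mxE eq_sym (negbTE cj) mulr0n mul0r.
under eq_bigr do rewrite !mxE.
apply: fpsP => k; rewrite fps_coefD fps_coefN fps_coefMC fps_coefXM.
case: k => [|k].
  by rewrite subr0 /alt_series imm_trace0 imm_ptrace0 fact0 invr1 !scale1r mul1r.
rewrite fps_coef_sum imm_ptraceS // scalerDr [X in _ + _ *: X]mulNrn scalerN.
congr (_ - _); first by rewrite -scalerAl.
rewrite (fact_mulrn k (\sum_c (imm_ptrace par true (fun i j => Z j i : S^c) k c i : S) * Z c j)).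
rewrite scaler_sumr; apply: eq_bigr => c _.
by rewrite fps_coefMC -scalerAl.
Qed.

Lemma mul_fpsX (A B : 'M[fps S]_N) : A *m (fpsX *: B) = fpsX *: (A *m B).
Proof.
apply/matrixP => i j; rewrite !mxE mulr_sumr; apply: eq_bigr => c _.
by rewrite !mxE !mulrA fpsXC.
Qed.

Lemma constmE Z : constm Z = mxfps (fpsC Z).
Proof.
apply/matrixP => i j; rewrite !mxE; apply: fpsP => -[|k] //.
by rewrite /fps_entry mxE.
Qed.

Lemma constmN Z : constm (- Z) = - constm Z.
Proof.
apply/matrixP => i j; rewrite !mxE; apply: fpsP => -[|k] //.
by rewrite fps_coefN oppr0.
Qed.

Lemma mxfps_char Z : mxfps (char_mx Z) = 1%:M + fpsX *: constm Z.
Proof. by apply/matrixP => i j; rewrite char_mxE !mxE. Qed.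

Lemma char_geom_mx Z : mxfps (char_mx Z) *m mxfps (geom_mx Z) = 1%:M.
Proof. by rewrite -mxfpsM char_geom mxfps1. Qed.

Lemma geom_char_mx Z : mxfps (geom_mx Z) *m mxfps (char_mx Z) = 1%:M.
Proof. by rewrite -mxfpsM geom_char mxfps1. Qed.

(** The recursion [alt_mx_rec] says that [alt_mx Z] times Z(u) is E Z; multiply by the inverse of
    Z(u). *)
Lemma alt_mxE Z : right_quantum_mx Z ->
  alt_mx Z = (alt_series Z)%:M *m constm Z *m mxfps (geom_mx Z).
Proof.
move=> Zq; rewrite -[LHS]mulmx1 -(char_geom_mx Z) mulmxA; congr (_ *m _).
by rewrite mxfps_char mulmxDr mulmx1 mul_fpsX {1}(alt_mx_rec Zq) subrK.
Qed.

Lemma sym_mxE Z : right_quantum_mx Z ->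
  sym_mx Z = mxfps (geom_mx (- Z)) *m constm Z *m (sym_series Z)%:M.
Proof.
move=> Zq; rewrite -[LHS]mul1mx -(geom_char_mx (- Z)) -!mulmxA; congr (_ *m _).
rewrite mxfps_char constmN mulmxDl mul1mx {1}(sym_mx_rec Zq) scalerN mulNmx.
by rewrite -scalemxAl addrK.
Qed.

Lemma mx_scalarl (f : fps S) (A : 'M[fps S]_N) i j : (f%:M *m A) i j = f * A i j.
Proof. by rewrite mul_scalar_mx mxE. Qed.

Lemma mx_scalarr (f : fps S) (A : 'M[fps S]_N) i j : (A *m f%:M) i j = A i j * f.
Proof.
rewrite mxE (bigD1 j) //= mxE eqxx mulr1n big1 ?addr0 // => c cj.
by rewrite mxE (negbTE cj) mulr0n mulr0.
Qed.

(** By [imm_trace_del], E_p = E - u ([alt_mx Z])_pp; then use u Z Z(u)^-1 = 1 - Z(u)^-1. *)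
Lemma alt_series_del Z p : right_quantum_mx Z -> ~~ par p ->
  alt_series (del_mx p Z) = alt_series Z * mxfps (geom_mx Z) p p.
Proof.
move=> Zq p0; have Zm := manin_converse Zq.
transitivity (alt_series Z - fpsX * alt_mx Z p p).
  apply: fpsP => k; rewrite fps_coefD fps_coefN fps_coefXM /alt_series.
  have -> : (fun i j => del_mx p Z j i : S^c) = del p (fun i j => Z j i : S^c).
    by apply: funext => i; apply: funext => j; rewrite mxE /del orbC.
  case: k => [|k]; first by rewrite subr0 !imm_trace0.
  rewrite imm_trace_del //; last exact: algebra_tf.
  rewrite (negbTE p0) sg_false scalerBr !mxE; congr (_ - _).
  exact: (fact_mulrn k (imm_ptrace par true (fun i j => Z j i : S^c) k p p : S)).
have -> : fpsX * alt_mx Z p p = (fpsX *: alt_mx Z) p p by rewrite [RHS]mxE.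
rewrite alt_mxE // -mulmxA -mul_fpsX mx_scalarl scalemxAl.
have -> : fpsX *: constm Z = mxfps (char_mx Z) - 1%:M by rewrite mxfps_char addrC addKr.
by rewrite mulmxBl char_geom_mx mul1mx !mxE eqxx mulrBr mulr1 opprB addrC subrK.
Qed.

(** For odd [p] the sign in [imm_trace_del] is reversed: H_p = H + u ([sym_mx Z])_pp; then use
    Z(-u)^-1 u Z = Z(-u)^-1 - 1. *)
Lemma sym_series_del Z p : right_quantum_mx Z -> par p ->
  sym_series (del_mx p Z) = mxfps (geom_mx (- Z)) p p * sym_series Z.
Proof.
move=> Zq p1; have Zm := manin_right_quantum Zq.
transitivity (sym_series Z + fpsX * sym_mx Z p p).
  apply: fpsP => k; rewrite fps_coefD fps_coefXM /sym_series.
  have -> : (fun i j => del_mx p Z i j) = del p (fun i j => Z i j).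
    by apply: funext => i; apply: funext => j; rewrite mxE.
  case: k => [|k]; first by rewrite addr0 !imm_trace0.
  rewrite imm_trace_del //; last exact: algebra_tf.
  by rewrite p1 /sg mulNrn opprK scalerDr !mxE fact_mulrn.
have -> : fpsX * sym_mx Z p p = (fpsX *: sym_mx Z) p p by rewrite [RHS]mxE.
rewrite sym_mxE // scalemxAl mx_scalarr -mul_fpsX.
have -> : fpsX *: constm Z = 1%:M - mxfps (char_mx (- Z)).
  by rewrite mxfps_char constmN scalerN opprD opprK addNKr.
rewrite mulmxBr mulmx1 geom_char_mx !mxE eqxx mulrBl mul1r addrC subrK //.
Qed.

Lemma alt_series0 Z : alt_series Z 0%N = 1.
Proof. by rewrite /alt_series imm_trace0 fact0 invr1 scale1r. Qed.

Lemma sym_series0 Z : sym_series Z 0%N = 1.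
Proof. by rewrite /sym_series imm_trace0 fact0 invr1 scale1r. Qed.

(** Differentiation replaces 1/(k+1)! by 1/k!, and the trace over k + 1 factors is the supertrace of
    the partial trace, so the derivative is the supertrace of [alt_mx Z]. *)
Lemma alt_newton Z : right_quantum_mx Z ->
  fps_deriv (alt_series Z) =
  alt_series Z * mxstr (constm Z *m mxfps (geom_mx Z)).
Proof.
move=> Zq; transitivity (mxstr (alt_mx Z)).
  apply: fpsP => k; rewrite /mxstr fps_coef_sum /fps_deriv /alt_series.
  rewrite scalerMnr fact_mulrn imm_traceS scaler_sumr.
  apply: eq_bigr => p _; rewrite -sgE mxE.
  by case: (par p); rewrite /sg ?fps_coefN // scalerN.
rewrite alt_mxE // /mxstr mulr_sumr; apply: eq_bigr => p _.
by rewrite -mulmxA mx_scalarl -!sgE sgMr.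
Qed.

Lemma sym_newton Z : right_quantum_mx Z ->
  fps_deriv (sym_series Z) =
  mxstr (constm Z *m mxfps (geom_mx (- Z))) * sym_series Z.
Proof.
move=> Zq; transitivity (mxstr (sym_mx Z)).
  apply: fpsP => k; rewrite /mxstr fps_coef_sum /fps_deriv /sym_series.
  rewrite scalerMnr fact_mulrn imm_traceS scaler_sumr.
  apply: eq_bigr => p _; rewrite -sgE mxE.
  by case: (par p); rewrite /sg ?fps_coefN // scalerN.
rewrite sym_mxE // /mxstr mulr_suml; apply: eq_bigr => p _.
rewrite mx_scalarr -!sgE sgMl; congr (sg _ (_ p p * _)).
(* [Z] commutes with the geometric series of [-Z], a series in powers of [Z]. *)
have H := geomC (- Z); rewrite constmE -!mxfpsM; congr mxfps.
apply: fpsP => k; move/(congr1 (fun f : fps _ => f k)): H.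
by rewrite !fps_coefCM !fps_coefMC mulrN mulNr => /oppr_inj.
Qed.

Lemma fps_deriv_eq0 (f : fps S) : f 0%N = 1 -> fps_deriv f = 0 -> f = 1.
Proof.
move=> f0 df; apply: fpsP => -[|k] //.
have /(congr1 (fun g : fps S => g k)) : fps_deriv f = 0 by [].
rewrite /fps_deriv -scaler_nat => /(congr1 (fun x => k.+1%:R^-1 *: x)).
by rewrite scalerA mulVf ?natr_neq0 // scale1r scaler0.
Qed.

Lemma right_quantum_mxN (R : pzRingType) (Z : 'M[R]_N) :
  right_quantum_mx Z -> right_quantum_mx (- Z).
Proof.
by move=> Zq i j k l; have := Zq i j k l; rewrite /scomm !mxE !mulrNN.
Qed.

(** A super form of MacMahon's master theorem. In the derivative of the product, the Newton
    identities put the same supertrace between the two series with opposite signs. *)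
Lemma macmahon_master Z : right_quantum_mx Z -> alt_series (- Z) * sym_series Z = 1.
Proof.
move=> Zq; apply: fps_deriv_eq0.
  by rewrite fps_coefM big_ord1 alt_series0 sym_series0 mulr1.
rewrite fps_derivM alt_newton ?sym_newton //; last exact: right_quantum_mxN.
rewrite -!mulrA -mulrDr -mulrDl constmN mulNmx.
have -> : mxstr (- (constm Z *m mxfps (geom_mx (- Z)))) =
   - mxstr (constm Z *m mxfps (geom_mx (- Z))).
  by rewrite /mxstr -sumrN; apply: eq_bigr => p _; rewrite mxE mulrN.
by rewrite addNr mul0r mulr0.
Qed.

End NewtonCayleyHamilton.

(** * The relations for the inverse matrix *)

Section CharacteristicMatrix.
Variables (S : pzRingType) (m n : nat).
Notation N := (m + n)%N.
Notation par := (@par m n).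
Implicit Types (a b : S) (f g : fps S).

Lemma scommE p q (R : pzRingType) (x y : R) :
  scomm p q x y = x * y - sg (p && q) (y * x).
Proof. by rewrite /scomm mulr_sgn oddM !oddb. Qed.

Lemma fpsCM a b : fpsC (a * b) = fpsC a * fpsC b.
Proof. by apply: fpsP => -[|k]; rewrite fps_coefCM ?mulr0. Qed.

Lemma fpsCB a b : fpsC (a - b) = fpsC a - fpsC b.
Proof. by apply: fpsP => -[|k]; rewrite fps_coefD fps_coefN ?subr0. Qed.

Lemma fpsC_sg t a : fpsC (sg t a) = sg t (fpsC a).
Proof. by case: t => //; apply: fpsP => -[|k]; rewrite /sg fps_coefN ?oppr0. Qed.

Lemma scomm_fpsX p q a b :
  scomm p q (fpsX * fpsC a) (fpsX * fpsC b) = fpsX * fpsX * fpsC (scomm p q a b).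
Proof.
have H x y : fpsX * fpsC x * (fpsX * fpsC y) = fpsX * fpsX * fpsC (x * y) :> fps S.
  by rewrite fpsCM !mulrA -(mulrA fpsX (fpsC x)) fpsXC !mulrA.
by rewrite !scommE !H fpsCB fpsC_sg mulrBr sgMr.
Qed.

Lemma scommDl (R : pzRingType) p q (x y z : R) :
  scomm p q (x + y) z = scomm p q x z + scomm p q y z.
Proof. by rewrite !scommE mulrDl mulrDr sgD opprD addrACA. Qed.

Lemma scommDr (R : pzRingType) p q (x y z : R) :
  scomm p q x (y + z) = scomm p q x y + scomm p q x z.
Proof. by rewrite !scommE mulrDl mulrDr sgD opprD addrACA. Qed.

Lemma scomm_deltal (R : pzRingType) (b p q : bool) (x : R) :
  (b -> ~~ p) -> scomm p q b%:R x = 0.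
Proof.
rewrite scommE; case: b => [/(_ isT)/negbTE->|_]; last by rewrite mul0r mulr0 sg0 subr0.
by rewrite mul1r mulr1 subrr.
Qed.

Lemma scomm_deltar (R : pzRingType) (b p q : bool) (x : R) :
  (b -> ~~ q) -> scomm p q x b%:R = 0.
Proof.
rewrite scommE; case: b => [/(_ isT)/negbTE->|_]; last by rewrite mul0r mulr0 sg0 subr0.
by rewrite andbF mul1r mulr1 subrr.
Qed.

(** Constant terms of entries are nonzero only on the diagonal, where the parity is even, so they
    supercommute with everything; only the terms in u^2 remain. *)
Lemma right_quantum_char (Z : 'M[S]_N) :
  right_quantum_mx Z -> right_quantum_mx (mxfps (char_mx Z)).
Proof.
have par_eq (i j : 'I_N) : i == j -> ~~ (par i (+) par j) by move/eqP->; rewrite addbb.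
move=> Zq i j k l; rewrite !char_mxE !scommDl !scommDr.
rewrite !(@scomm_deltal _ (_ == _)) ?add0r; try exact: par_eq.
rewrite !(@scomm_deltar _ (_ == _)) ?add0r; try exact: par_eq.
by rewrite !scomm_fpsX Zq !mulr_sgn fpsC_sg sgMr.
Qed.

End CharacteristicMatrix.

Section InverseManin.
Variables (m n : nat).
Notation N := (m + n)%N.
Notation par := (@par m n).
Notation T := ('I_N * 'I_N)%type.

Section Pairs.
Variable R : pzRingType.

(** Operators on the tensor square become ordinary square matrices, so that matrix algebra applies
    to W_1 W_2 and P. *)
Definition mxpair (f : T -> T -> R) : 'M[R]_#|{: T}| :=
  \matrix_(a, b) f (enum_val a) (enum_val b).

Lemma mxpairM f g : mxpair f *m mxpair g = mxpair (fun x y => \sum_z f x z * g z y).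
Proof.
apply/matrixP => a b; rewrite !mxE [RHS](reindex (fun c : 'I_#|{: T}| => enum_val c)) /=.
  by apply: eq_bigr => c _; rewrite !mxE.
exact/onW_bij/enum_val_bij.
Qed.

Lemma mxpair_inj f g : mxpair f = mxpair g -> f =2 g.
Proof.
move=> /matrixP E x y; have := E (enum_rank x) (enum_rank y).
by rewrite !mxE !enum_rankK.
Qed.

Lemma mxpair1 : mxpair (fun x y => (x == y)%:R) = 1%:M.
Proof. by apply/matrixP => a b; rewrite !mxE (inj_eq enum_val_inj). Qed.

Definition swap_fun (x y : T) : R :=
  if x == (y.2, y.1) then sg (par x.1 && par x.2) 1 else 0.

Lemma swapl f : mxpair swap_fun *m mxpair f =
  mxpair (fun x y => sg (par x.1 && par x.2) (f (x.2, x.1) y)).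
Proof.
rewrite mxpairM; congr mxpair; apply: funext => -[x1 x2]; apply: funext => y.
rewrite (bigD1 (x2, x1)) //= /swap_fun /= eqxx sgMl mul1r big1 ?addr0 // => -[z1 z2] nz.
rewrite xpair_eqE /=; case: ifP => [/andP[/eqP e1 /eqP e2]|_]; last by rewrite mul0r.
by rewrite e1 e2 eqxx in nz.
Qed.

Lemma swapr f : mxpair f *m mxpair swap_fun =
  mxpair (fun x y => sg (par y.1 && par y.2) (f x (y.2, y.1))).
Proof.
rewrite mxpairM; congr mxpair; apply: funext => x; apply: funext => -[y1 y2].
rewrite (bigD1 (y2, y1)) //= /swap_fun eqxx /= sgMr mulr1 big1 ?addr0 => [|z nz].
  by rewrite andbC.
by rewrite (negbTE nz) mulr0.
Qed.

Lemma swap_invol : mxpair swap_fun *m mxpair swap_fun = 1%:M.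
Proof.
rewrite swapl -mxpair1; congr mxpair; apply: funext => -[x1 x2]; apply: funext => -[y1 y2].
rewrite /swap_fun /= !xpair_eqE [in RHS]andbC; case: ifP => _; last by rewrite sg0.
by rewrite sgA (andbC (par x2)) addbb.
Qed.

(** The coefficients of W_1 W_2; those of W_2 W_1 are given by [cotensor_fun]. *)
Definition tensor_fun (w : 'I_N -> 'I_N -> R) (x y : T) : R :=
  sg ((par x.1 (+) par y.1) && par x.2) (w x.1 y.1 * w x.2 y.2).

Definition cotensor_fun (w : 'I_N -> 'I_N -> R) (x y : T) : R :=
  sg ((par x.1 (+) par y.1) && par y.2) (w x.2 y.2 * w x.1 y.1).

(* (1 - P) X (1 + P) for X with coefficients f *)
Definition sandwich (f : T -> T -> R) (x y : T) : R :=
  (f x y + sg (par y.1 && par y.2) (f x (y.2, y.1))) -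
  (sg (par x.1 && par x.2) (f (x.2, x.1) y) +
   sg ((par x.1 && par x.2) (+) (par y.1 && par y.2)) (f (x.2, x.1) (y.2, y.1))).

Lemma sandwichE f :
  (1%:M - mxpair swap_fun) *m mxpair f *m (1%:M + mxpair swap_fun) = mxpair (sandwich f).
Proof.
rewrite mulmxBl mul1mx mulmxDr mulmx1 mulmxBl !(swapl, swapr).
apply/matrixP => a b; rewrite !mxE /sandwich sgA (addbC (par (enum_val b).1 && _)).
by rewrite addrACA -opprD.
Qed.

Lemma manin_tensor w : manin par false w -> forall x y, sandwich (tensor_fun w) x y = 0.
Proof.
move=> wm [p r] [c x]; rewrite /sandwich /tensor_fun /=; apply/eqP; rewrite subr_eq0; apply/eqP.
have := congr1 (sg (par p && par r)) (wm p r c x); rewrite !sgD !sgA.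
move=> E; etransitivity; [|etransitivity; [exact: E|]];
  congr (sg _ _ + sg _ _);
  by case: (par p); case: (par r); case: (par c); case: (par x).
Qed.

(** Exchanging the two tensor factors turns W_2 W_1 into W_1 W_2, whence the reversed index
    pairs. *)
Lemma cotensor_manin w : (forall x y, sandwich (cotensor_fun w) x y = 0) -> manin par false w.
Proof.
move=> H p r c x; have /eqP := H (r, p) (x, c); rewrite /sandwich /cotensor_fun /= subr_eq0.
move/eqP/(congr1 (sg (par c && par x))); rewrite !sgD !sgA => E.
etransitivity; [|etransitivity; [exact: E|]];
  congr (sg _ _ + sg _ _);
  by case: (par p); case: (par r); case: (par c); case: (par x).
Qed.

(** The inverse of W_1 W_2 is Y_2 Y_1: the sum over the second index collapses first, then the one
    over the first index. *)
Lemma tensorV (W Y : 'M[R]_N) : W *m Y = 1%:M ->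
  mxpair (tensor_fun (fun i j => W i j)) *m mxpair (cotensor_fun (fun i j => Y i j)) = 1%:M.
Proof.
move=> /matrixP WY; rewrite mxpairM -mxpair1; congr mxpair.
apply: funext => -[i1 i2]; apply: funext => -[j1 j2].
transitivity (\sum_c1 sg ((par i1 (+) par c1) && par i2 (+) ((par c1 (+) par j1) && par j2))
   (W i1 c1 * (\sum_c2 W i2 c2 * Y c2 j2) * Y c1 j1)).
  rewrite -(pair_bigA _ (fun c1 c2 => tensor_fun _ (i1, i2) (c1, c2) * cotensor_fun _ (c1, c2) _)).
  apply: eq_bigr => c1 _; rewrite mulr_sumr mulr_suml sg_sum; apply: eq_bigr => c2 _.
  by rewrite /tensor_fun /cotensor_fun /= sgMl sgMr sgA !mulrA.
have E2 : \sum_c2 W i2 c2 * Y c2 j2 = (i2 == j2)%:R by have := WY i2 j2; rewrite !mxE.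
have E1 : \sum_c1 W i1 c1 * Y c1 j1 = (i1 == j1)%:R by have := WY i1 j1; rewrite !mxE.
rewrite E2 xpair_eqE; case: (eqVneq i2 j2) => [<-|_]; last first.
  by rewrite andbF big1 // => c _; rewrite mulr0 mul0r sg0.
rewrite andbT -E1.
transitivity (\sum_c1 sg ((par i1 (+) par j1) && par i2) (W i1 c1 * Y c1 j1)).
  apply: eq_bigr => c _; rewrite mulr1; congr (sg _ _).
  by case: (par i1); case: (par i2); case: (par j1); case: (par c).
rewrite -sg_sum E1; case: (eqVneq i1 j1) => [->|_]; first by rewrite addbb.
by rewrite sg0.
Qed.

End Pairs.

Variable S : pzRingType.
Hypothesis S_tf : forall x : S, x + x = 0 -> x = 0.

Lemma mulmx_low_coef q (A B : 'M[fps S]_q) k x y :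
  (forall l z, (l < k)%N -> B z y l = 0) ->
  (A *m B) x y k = \sum_z A x z 0%N * B z y k.
Proof.
move=> B0; rewrite mxE fps_coef_sum; apply: eq_bigr => z _.
rewrite fps_coefM big_ord_recl subn0 big1 ?addr0 // => i _.
by rewrite B0 ?mulr0 // lift0 ltn_subrL /= (leq_trans _ (ltn_ord i)).
Qed.

(* With a := 1 - P, h := 1 + P and T := W_1 W_2, the relation a T h = 0 gives
   2 a T = a T a, so that B := a T^-1 h satisfies a T B = 2 a h = 0 and
   a B = 2 B; comparing lowest terms in u yields B = 0. *)
Lemma manin_inverse (W Y : 'M[fps S]_N) :
  (forall i j, W i j 0%N = (i == j)%:R) -> W *m Y = 1%:M ->
  manin par false (fun i j => W i j) -> manin par false (fun i j => Y i j).
Proof.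
move=> W0 WY Wm; apply: cotensor_manin.
pose P : 'M[fps S]_#|{: T}| := mxpair (swap_fun (fps S)).
pose a := 1%:M - P; pose h := 1%:M + P.
pose X := mxpair (tensor_fun (fun i j => W i j)).
pose V := mxpair (cotensor_fun (fun i j => Y i j)).
have XV : X *m V = 1%:M by exact: tensorV.
have PP : P *m P = 1%:M by exact: swap_invol.
have ah : a *m h = 0.
  by rewrite mulmxDr mulmx1 mulmxBl mul1mx PP addrA subrK subrr.
have aa : a *m a = a + a.
  by rewrite mulmxBr mulmx1 mulmxBl mul1mx PP opprB.
have aXh : a *m X *m h = 0.
  by rewrite sandwichE; apply/matrixP => i j; rewrite !mxE manin_tensor.
pose B := a *m V *m h.
have aB : a *m B = B + B by rewrite /B !mulmxA aa mulmxDl mulmxDl.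
have aXa : a *m X *m a = a *m X + a *m X.
  have aE : a = 1%:M + 1%:M - h by rewrite opprD addrA addrK.
  transitivity (a *m X *m (1%:M + 1%:M - h)); first by rewrite -aE.
  by rewrite mulmxBr aXh subr0 mulmxDr mulmx1.
have aXB : a *m X *m B = 0.
  by rewrite /B !mulmxA aXa mulmxDl mulmxDl -!mulmxA (mulmxA X) XV mul1mx ah addr0.
have X0 x y : X x y 0%N = (x == y)%:R.
  rewrite mxE /tensor_fun -[x == y](inj_eq enum_val_inj).
  case: (enum_val x) (enum_val y) => [i1 i2] [j1 j2] /=; rewrite xpair_eqE.
  have sg_coef b (f : fps S) : sg b f 0%N = sg b (f 0%N) by case: b.
  rewrite sg_coef fps_coefM big_ord1 !W0; case: (eqVneq i1 j1) => [->|_].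
    by rewrite addbb mul1r.
  by rewrite mul0r sg0.
have B0 k : forall x y, B x y k = 0.
  elim/ltn_ind: k => k IH x y.
  have low l z : (l < k)%N -> B z y l = 0 by move=> lk; apply: IH.
  have aX0 u v : (a *m X) u v 0%N = a u v 0%N.
    rewrite mxE fps_coef_sum (bigD1 v) //= fps_coefM big_ord1 X0 eqxx mulr1.
    rewrite big1 ?addr0 // => z zv.
    by rewrite fps_coefM big_ord1 X0 (negbTE zv) mulr0.
  apply: S_tf; rewrite -fps_coefD.
  have -> : B x y + B x y = (a *m B) x y by rewrite aB [RHS]mxE.
  rewrite mulmx_low_coef //; have : (a *m X *m B) x y k = 0 by rewrite aXB mxE.
  by rewrite mulmx_low_coef //; under eq_bigr do rewrite aX0.
move=> x y; have : B = mxpair (fun _ _ => 0).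
  by apply/matrixP => i j; rewrite [RHS]mxE; apply: fpsP => k; rewrite B0.
by rewrite /B sandwichE => /mxpair_inj ->.
Qed.

End InverseManin.

(** * The Berezinian *)

Lemma odd_perm_inversions k (s : 'S_k) :
  odd (\sum_(a < k) \sum_(b < k | (a < b)%N && (s b < s a)%N) 1)%N = odd_perm s.
Proof.
elim: k s => [|k IH] s; first by rewrite big_ord0 [s]permS0 odd_perm1.
have [g _ gK] := lift_perm_bij k; rewrite -(gK s); case: (g s) => i t.
(* With all letters declared odd, [inversions] counts every inversion of the permutation. *)
have := inversions_lift (fun _ : bool => true) i t [ffun _ => true].
rewrite /inversions /= => ->.
rewrite oddD IH odd_lift_perm /= addbF; congr (_ (+) _).
by rewrite mul1n -(big_ord_widen k.+1 (fun=> 1%N)) ?sum1_card ?card_ord // ltnW.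
Qed.

Section Berezinian.
Variables (F : fieldType) (S : algType F) (m n : nat).
Hypothesis F0 : [pchar F] =i pred0.
Notation N := (m + n)%N.
Notation par := (@par m n).
Implicit Types (Z : 'M[S]_N) (D : pred 'I_N) (K L : seq 'I_N).

Definition res_mx (D : pred 'I_N) Z : 'M[S]_N :=
  \matrix_(i, j) (if D i && D j then Z i j else 0).

Lemma right_quantum_res D Z : right_quantum_mx Z -> right_quantum_mx (res_mx D Z).
Proof.
move=> Zq i j k l; have := Zq i j k l; rewrite /scomm !mxE.
by case: (D i); case: (D j); case: (D k); case: (D l);
   rewrite /= ?(mul0r, mulr0, subr0).
Qed.

Lemma del_res p D D' Z : (forall i, D' i = D i && (i != p)) ->
  del_mx p (res_mx D Z) = res_mx D' Z.
Proof.
move=> DD'; apply/matrixP => i j; rewrite !mxE /del !mxE !DD'.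
by case: (i == p); case: (j == p); rewrite ?andbT ?andbF.
Qed.

Notation W Z := (mxfps (char_mx Z)).
Notation V Z := (mxfps (geom_mx Z)).

Lemma char_res_in D Z i j : D i -> D j -> W (res_mx D Z) i j = W Z i j.
Proof. by move=> Di Dj; rewrite !char_mxE mxE Di Dj. Qed.

Lemma fpsX_C0 : fpsX * fpsC 0 = 0 :> fps S.
Proof. by apply: fpsP => k; rewrite fps_coefMC mulr0. Qed.

Lemma char_res_outr D Z i j : ~~ D j -> W (res_mx D Z) i j = (i == j)%:R.
Proof. by move=> Dj; rewrite char_mxE mxE (negbTE Dj) andbF fpsX_C0 addr0. Qed.

Lemma char_res_outl D Z i j : ~~ D i -> W (res_mx D Z) i j = (i == j)%:R.
Proof. by move=> Di; rewrite char_mxE mxE (negbTE Di) fpsX_C0 addr0. Qed.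

Lemma fps_tf (f : fps S) : f + f = 0 -> f = 0.
Proof.
move=> ff; apply: fpsP => k; apply: (algebra_tf F0).
by rewrite -fps_coefD ff.
Qed.

Lemma geom_pp0 Z p : V Z p p 0%N = 1.
Proof. by rewrite mxE /fps_entry /geom_mx expr0 mxE eqxx. Qed.

Lemma alt_series_zero : alt_series (0 : 'M[S]_N) = 1.
Proof.
apply: (fps_deriv_eq0 F0); first exact: alt_series0.
rewrite (alt_newton F0); last by move=> i j k l; rewrite /scomm !mxE !mulr0 subr0 mulr0.
rewrite /mxstr big1 ?mulr0 // => p _; rewrite mxE big1 ?mulr0 // => i _.
by rewrite !mxE; apply: fpsP => k; rewrite fps_coefCM mul0r.
Qed.

(** Induction on [K]: by [alt_series_del] on one side and Cramer's rule on the other, both values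
    for [L] are those for [p :: L] times [U p p]. This entry has constant term 1, so it can be
    cancelled. *)
Lemma alt_series_even Z K : right_quantum_mx Z -> uniq K -> {in K, forall i, ~~ par i} ->
  alt_series (res_mx (mem K) Z) =
  (superimm par true (fun i j => W Z j i : (fps S)^c) K K : fps S).
Proof.
move=> Zq; elim: K => [|p L IH] Ku Ke.
  have -> : res_mx (mem [::]) Z = 0 by apply/matrixP => i j; rewrite !mxE.
  exact: alt_series_zero.
have pe : ~~ par p by apply: Ke; rewrite mem_head.
have Wm : manin par true (fun i j => W Z j i : (fps S)^c).
  exact: manin_converse (right_quantum_char Zq).
have [pL Lu] := andP Ku.
set K := p :: L; set U := V (res_mx (mem K) Z).
have E1 : alt_series (res_mx (mem L) Z) = alt_series (res_mx (mem K) Z) * U p p.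
  rewrite -alt_series_del //; last exact: right_quantum_res.
  congr alt_series; apply/esym/del_res => i; rewrite /= inE.
  by case: (eqVneq i p) => [->|_] //=; rewrite ?andbT // (negbTE pL).
have E2 : superimm par true (fun i j => W Z j i : (fps S)^c) L L =
   (superimm par true (fun i j => W Z j i : (fps S)^c) K K : fps S) * U p p.
  apply: (superimm_cramer (S := (fps S)^c) fps_tf Wm (v := fun i j => U j i)) => //.
  move=> i l iK lK.
  suff : \sum_(j <- K) W Z l j * U j i = (i == l)%:R by [].
  have /matrixP/(_ l i) : W (res_mx (mem K) Z) *m U = 1%:M by exact: char_geom_mx.
  rewrite [LHS]mxE [RHS]mxE eq_sym => <-.
  (* In the columns outside [K] the restricted matrix is the identity, so the sum reduces to [K],
     where its entries are those of Z(u). *)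
  rewrite [RHS](bigID (mem K)) /= [X in _ = _ + X]big1 ?addr0 => [|j jK].
    rewrite -big_uniq //= big_seq [RHS]big_seq; apply: eq_bigr => j jK.
    by rewrite -(char_res_in Z lK jK).
  rewrite char_res_outr //; case: eqP => [lj|]; last by rewrite mul0r.
  by rewrite -lj lK in jK.
have Le : {in L, forall i, ~~ par i} by move=> i iL; apply: Ke; rewrite inE iL orbT.
have := IH Lu Le; rewrite E1 [X in _ = X]E2.
move/(congr1 (fun f => f * fps_inv (U p p))).
by rewrite -!mulrA fps_mulfV ?mulr1 // geom_pp0.
Qed.


(* The constant term is set to 1 so that the series stays invertible. *)
Definition block_series D (A : fps 'M[S]_N) : fps 'M[S]_N :=
  fun k => if k is 0 then 1 else res_mx D (A k).

Lemma block_in D A i j : A 0%N = 1 -> D i -> D j ->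
  mxfps (block_series D A) i j = mxfps A i j.
Proof.
move=> A0 Di Dj; rewrite !mxE; apply: fpsP => -[|k]; rewrite /fps_entry /= ?A0 //.
by rewrite mxE Di Dj.
Qed.

Lemma block_out D A i j : ~~ D i || ~~ D j ->
  mxfps (block_series D A) i j = (i == j)%:R.
Proof.
move=> Dij; rewrite !mxE; apply: fpsP => -[|k]; rewrite /fps_entry /= mxE.
  by case: (i == j).
by move: Dij; rewrite -negb_and => /negbTE ->; case: (i == j).
Qed.

Lemma res_mxT Z : res_mx predT Z = Z.
Proof. by apply/matrixP => i j; rewrite mxE. Qed.

(** Apply [sym_series_del] to [-Z] and invert, as H(-u) and E(u) are inverse to each other by
    [macmahon_master]. *)
Lemma alt_series_del_odd Z p : right_quantum_mx Z -> par p ->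
  alt_series Z = alt_series (del_mx p Z) * V Z p p.
Proof.
move=> Zq pp; have Nq := right_quantum_mxN Zq.
have H := sym_series_del F0 Nq pp; rewrite opprK in H.
have delN : del_mx p (- Z) = - del_mx p Z.
  by apply/matrixP => i j; rewrite !mxE /del !mxE; case: ifP; rewrite ?oppr0.
have M1 : alt_series Z * sym_series (- Z) = 1 by rewrite -{1}[Z]opprK macmahon_master.
have delq : right_quantum_mx (del_mx p Z).
  rewrite -(res_mxT Z) (@del_res p predT (predC1 p)) //; exact: right_quantum_res.
have M2 : alt_series (del_mx p Z) * sym_series (del_mx p (- Z)) = 1.
  rewrite delN -{1}[del_mx p Z]opprK macmahon_master //; exact: right_quantum_mxN.
have M3 : sym_series (- Z) * alt_series Z = 1.
  rewrite -(fps_inv_unique (alt_series0 Z) M1) fps_mulVf //; exact: alt_series0.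
by rewrite -[LHS]mul1r -M2 H -!mulrA M3 mulr1.
Qed.

(** Passing from [L] to [p :: L] takes a factor [Q p p] out of the series and, by Cramer's rule, a
    factor [v p p] out of the row determinant. Their product is 1, as for complementary minors of a
    matrix and its inverse. *)
Lemma alt_series_odd Z K : right_quantum_mx Z -> uniq K -> {in K, forall i, par i} ->
  alt_series (res_mx (fun i => i \notin K) Z) *
    superimm par false (fun i j => V Z i j) K K = alt_series Z.
Proof.
move=> Zq; elim: K => [|p L IH] Ku Ko.
  by rewrite /= mulr1 -[in RHS](res_mxT Z).
have po : par p by apply: Ko; rewrite mem_head.
have Lo : {in L, forall i, par i} by move=> i iL; apply: Ko; rewrite inE iL orbT.
have [pL Lu] := andP Ku.
rewrite -{}IH //; set K := p :: L.
set ZL := res_mx (fun i => i \notin L) Z; set Q := V ZL.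
have Vm : manin par false (fun i j => V Z i j).
  apply: (manin_inverse (algebra_tf F0) _ (char_geom_mx Z)).
    by move=> i j; rewrite mxE /fps_entry char_mx0 mxE.
  exact: manin_right_quantum (right_quantum_char Zq).
pose A := block_series (mem K) (geom_mx Z).
have A0 : A 0%N = 1 by [].
have g0 : geom_mx Z 0%N = 1 by rewrite /geom_mx expr0.
pose v := mxfps (fps_inv A).
have vA : v *m mxfps A = 1%:M by rewrite -mxfpsM fps_mulVf // mxfps1.
have Av : mxfps A *m v = 1%:M by rewrite -mxfpsM fps_mulfV // mxfps1.
have -> : superimm par false (fun i j => V Z i j) L L =
    v p p * superimm par false (fun i j => V Z i j) K K.
  apply: (superimm_cramer fps_tf Vm (v := fun i j => v i j)) => // i l iK lK.
  have /matrixP/(_ i l) := vA; rewrite [LHS]mxE [RHS]mxE => <-.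
  rewrite [RHS](bigID (mem K)) /= [X in _ = _ + X]big1 ?addr0 => [|j jK].
    rewrite -big_uniq //= big_seq [RHS]big_seq; apply: eq_bigr => j jK.
    by rewrite block_in.
  rewrite block_out ?jK //; case: eqP => [jl|]; last by rewrite mulr0.
  by rewrite jl lK in jK.
have ZLq : right_quantum_mx ZL by exact: right_quantum_res.
have -> : alt_series ZL = alt_series (res_mx (fun i => i \notin K) Z) * Q p p.
  rewrite (alt_series_del_odd ZLq po); congr (alt_series _ * _).
  by apply: del_res => i; rewrite inE negb_or andbC.
rewrite -!mulrA; congr (_ * _); rewrite mulrA -[LHS]mul1r; congr (_ * _).
(* On the complement of L, the vector t := Y_(., K) v_(., p) solves
   (1 + u Z) t = v_pp e_p, and t_p = 1. *)
pose t i := \sum_(j in K) V Z i j * v j p.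
have tK i : i \in K -> t i = (i == p)%:R.
  move=> iK; have /matrixP/(_ i p) := Av; rewrite [LHS]mxE [RHS]mxE => <-.
  rewrite [RHS](bigID (mem K)) /= [X in _ = _ + X]big1 ?addr0 => [|j jK].
    by apply: eq_bigr => j jK; rewrite block_in.
  rewrite block_out ?jK ?orbT //; case: eqP => [ij|]; last by rewrite mul0r.
  by rewrite -ij iK in jK.
have Wt i : \sum_j W ZL i j * t j = if i == p then v p p else 0.
  have [iL|iL] := boolP (i \in L).
    rewrite (bigD1 i) //= big1 ?addr0 => [|j ji]; last first.
      by rewrite char_res_outl ?negbK // eq_sym (negbTE ji) mul0r.
    have ip : i == p = false by apply/eqP => ip; rewrite -ip iL in pL.
    by rewrite tK ?inE ?iL ?orbT // ip mulr0.
  transitivity (\sum_j W Z i j * t j).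
    apply: eq_bigr => j _; have [jL|jL] := boolP (j \in L); last by rewrite char_res_in.
    have jp : j == p = false by apply/eqP => jp; rewrite -jp jL in pL.
    by rewrite tK ?inE ?jL ?orbT // jp !mulr0.
  transitivity (\sum_(l in K) (\sum_j W Z i j * V Z j l) * v l p).
    under eq_bigr do rewrite mulr_sumr.
    rewrite exchange_big; apply: eq_bigr => l _ /=.
    by rewrite mulr_suml; apply: eq_bigr => j _; rewrite mulrA.
  have WV l : \sum_j W Z i j * V Z j l = (i == l)%:R.
    by have /matrixP/(_ i l) := char_geom_mx Z; rewrite [LHS]mxE [RHS]mxE.
  under eq_bigr do rewrite WV.
  case: eqP => [->|/eqP ip].
    rewrite (bigD1 p) ?mem_head //= eqxx mul1r big1 ?addr0 // => l /andP[_ lp].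
    by rewrite eq_sym (negbTE lp) mul0r.
  rewrite big1 // => l lK; case: eqP => [il|]; last by rewrite mul0r.
  by rewrite -il inE (negbTE ip) (negbTE iL) in lK.
have : t p = Q p p * v p p.
  transitivity (\sum_i Q p i * \sum_j W ZL i j * t j).
    under eq_bigr do rewrite mulr_sumr.
    rewrite exchange_big /= (bigD1 p) //= [X in _ = _ + X]big1 ?addr0 => [|j jp].
      under eq_bigr do rewrite mulrA.
      rewrite -mulr_suml; have /matrixP/(_ p p) := geom_char_mx ZL.
      by rewrite [LHS]mxE [RHS]mxE eqxx => ->; rewrite mul1r.
    under eq_bigr do rewrite mulrA.
    rewrite -mulr_suml; have /matrixP/(_ p j) := geom_char_mx ZL.
    by rewrite [LHS]mxE [RHS]mxE eq_sym (negbTE jp) => ->; rewrite mul0r.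
  rewrite (bigD1 p) //= Wt eqxx big1 ?addr0 // => i ip.
  by rewrite Wt (negbTE ip) mulr0.
by rewrite tK ?mem_head // eqxx => <-.
Qed.

End Berezinian.

(** * The two determinants in the Berezinian *)

Section BerezinianFormula.
Variables (m n : nat).
Notation N := (m + n)%N.
Notation par := (@par m n).

Lemma par_lshift i : par (lshift n i) = false.
Proof. by rewrite /Defs.par leqNgt /= ltn_ord. Qed.

Lemma par_rshift j : par (rshift m j) = true.
Proof. exact: leq_addr. Qed.

(* Reversed because the converse ring reverses the products. *)
Definition even_word : seq 'I_N := word [ffun a : 'I_m => lshift n (rev_ord a)].
Definition odd_word : seq 'I_N := word [ffun a : 'I_n => rshift m a].

Lemma uniq_word k (J : {ffun 'I_k -> 'I_N}) : injective J -> uniq (word J).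
Proof. by move=> Jinj; rewrite map_inj_uniq // enum_uniq. Qed.

Lemma uniq_even_word : uniq even_word.
Proof. by apply: uniq_word => a b; rewrite !ffunE => /lshift_inj/rev_ord_inj. Qed.

Lemma uniq_odd_word : uniq odd_word.
Proof. by apply: uniq_word => a b; rewrite !ffunE => /rshift_inj. Qed.

Lemma mem_even_word i : (i \in even_word) = ~~ par i.
Proof.
apply/mapP/idP => [[a _ ->]|]; first by rewrite ffunE par_lshift.
case: (split_ordP i) => j ->; last by rewrite par_rshift.
by exists (rev_ord j); rewrite ?mem_enum // ffunE rev_ordK.
Qed.

Lemma mem_odd_word i : (i \in odd_word) = par i.
Proof.
apply/mapP/idP => [[a _ ->]|]; first by rewrite ffunE par_rshift.
case: (split_ordP i) => j ->; first by rewrite par_lshift.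
by exists j; rewrite ?mem_enum // ffunE.
Qed.

Variable R : pzRingType.
Implicit Type w : 'I_N -> 'I_N -> R.

(** All letters are even, so the only sign left is that of the permutation, supplied by
    [e = true]. *)
Lemma column_determinant w :
  \sum_(s : 'S_m) (-1) ^+ s * \prod_(i < m) w (lshift n (s i)) (lshift n i) =
  (superimm par true (fun i j => w j i : R^c) even_word even_word : R).
Proof.
rewrite -superimm_perm; set J := [ffun _ => _].
pose r := perm (@rev_ord_inj m).
(* The inverse enters because [permute s] moves letters by the inverse of [s], the conjugation
   because [even_word] is reversed. *)
rewrite (reindex_inj (h := fun s => (r * s^-1 * r)%g)) => [|s t /mulIg/mulgI/invg_inj//].
apply: eq_bigr => s _; rewrite -sgE !odd_permM odd_permV addbAC addbb addFb.
have -> : inversions par s J = 0%N.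
  by rewrite /inversions big1 // => a _; rewrite big1 // => b _; rewrite ffunE par_lshift.
rewrite addbF; congr (sg _ _); rewrite prod_converse; apply: eq_bigr => a _.
by rewrite !permM [r (rev_ord a)]permE rev_ordK [r _]permE !ffunE !par_lshift.
Qed.

(** All letters are odd, so with [e = false] the inversions supply the sign of the permutation, by
    [odd_perm_inversions]. *)
Lemma row_determinant w :
  \sum_(t : 'S_n) (-1) ^+ t * \prod_(j < n) w (rshift m j) (rshift m (t j)) =
  superimm par false w odd_word odd_word.
Proof.
rewrite -superimm_perm; set J := [ffun _ => _].
rewrite (reindex_inj invg_inj); apply: eq_bigr => s _; rewrite -sgE odd_permV.
have -> : odd (inversions par s J) = odd_perm s.
  rewrite -odd_perm_inversions; congr odd; apply: eq_bigr => a _.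
  by apply: eq_bigr => b _; rewrite !ffunE !par_rshift.
rewrite addFb; congr (sg _ _); apply: eq_bigr => a _.
by rewrite !ffunE !par_rshift addbb sg_false.
Qed.

End BerezinianFormula.

Section BerezinianExpansion.
Variables (F : fieldType) (S : algType F) (m n : nat).
Hypothesis F0 : [pchar F] =i pred0.
Implicit Type Z : 'M[S]_(m + n).

(** Removing the odd indices splits off the row determinant of Z(u)^-1 and leaves the series of the
    even block, which is a column determinant. *)
Lemma Ber_char Z : right_quantum_mx Z -> Ber (char_mx Z) = alt_series Z.
Proof.
move=> Zq; rewrite -(alt_series_odd F0 Zq (uniq_odd_word m n)); last first.
  by move=> i; rewrite mem_odd_word.
have -> : res_mx (fun i => i \notin odd_word m n) Z = res_mx (mem (even_word m n)) Z.
  by apply/matrixP => i j; rewrite !mxE /= !mem_odd_word !mem_even_word.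
rewrite (alt_series_even F0 Zq (uniq_even_word m n)); last first.
  by move=> i; rewrite mem_even_word.
rewrite -column_determinant -row_determinant /Ber fps_inv_char; congr (_ * _).
  by apply: eq_bigr => s _; congr (_ * _); apply: eq_bigr => i _; rewrite mxE.
by apply: eq_bigr => s _; congr (_ * _); apply: eq_bigr => i _; rewrite mxE.
Qed.

Lemma char_mxN Z : char_mx (- Z) = 1 - fpsX * fpsC Z.
Proof.
rewrite /char_mx -mulrN; congr (_ + _ * _).
by apply: fpsP => -[|k]; rewrite fps_coefN //= oppr0.
Qed.

Lemma fps_inv_Ber_charN Z : right_quantum_mx Z ->
  fps_inv (Ber (char_mx (- Z))) = sym_series Z.
Proof.
move=> Zq; have Nq := right_quantum_mxN Zq; rewrite Ber_char //.
by apply: fps_inv_unique; [exact: alt_series0 | exact: macmahon_master].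
Qed.

Lemma Ber_newton Z : right_quantum_mx Z ->
  fps_inv (Ber (char_mx Z)) * fps_deriv (Ber (char_mx Z)) =
  ((fun k => (-1) ^+ k * mxstr (Z ^+ k.+1)) : fps S).
Proof.
move=> Zq; rewrite Ber_char // alt_newton // mulrA fps_mulVf ?alt_series0 // mul1r.
apply: fpsP => k; rewrite constmE -mxfpsM /mxstr fps_coef_sum mulr_sumr.
apply: eq_bigr => i _; rewrite -!sgE [in RHS]mulr_sgn sgA addbC -sgA.
have -> (f : fps S) : sg (par i) f k = sg (par i) (f k) by case: (par i).
congr (sg _ _); rewrite mxE /fps_entry fps_coefCM /geom_mx exprNn.
by rewrite mulr_sgn sgMr -exprS; case: (odd k); rewrite /sg ?mxE.
Qed.

End BerezinianExpansion.

Theorem theorem2p13 (R : realType) (m n : nat) (mn_gt0 : (0 < m + n)%N) :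
  let C : fieldType := R[i] in
  let M := rqM C m n in
  let Z : 'M[M]_(m + n) := \matrix_(i, j) rq_gen C i j in
  let BerP : fps M := Ber (1 + fpsX * fpsC Z) in
  let BerN : fps M := Ber (1 - fpsX * fpsC Z) in
  [/\ BerP =
        ((fun k => strk (Asym C m n k * \prod_(a < k) Zpos C m n a)) : fps M),
      fps_inv BerN =
        ((fun k => strk (Hsym C m n k * \prod_(a < k) Zpos C m n a)) : fps M)
    & fps_inv BerP * fps_deriv BerP =
        ((fun k => (-1) ^+ k * mxstr (Z ^+ k.+1)) : fps M)].
Proof.
move=> C M Z BerP BerN.
have C0 : [pchar C] =i pred0 by exact: Num.Theory.pchar_num.
have ZE : (fun i j => Z i j) = @rq_gen C m n.
  by apply: funext => i; apply: funext => j; rewrite mxE.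
have Zq : right_quantum_mx Z by rewrite /right_quantum_mx ZE; exact: rq_gen_rel.
split.
- rewrite /BerP -/(char_mx Z) Ber_char //; apply: fpsP => k.
  rewrite strk_Asym /alt_series.
  by have -> : (fun i j => Z j i) = (fun i j => rq_gen C j i) by rewrite -ZE.
- rewrite /BerN -char_mxN fps_inv_Ber_charN //; apply: fpsP => k.
  by rewrite strk_Hsym /sym_series ZE.
- exact: Ber_newton.
Qed.
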